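(* Let $n\ge 2$. Then $$\inf_{0<\alpha<n/2}\gamma_n(\alpha)\le \frac12 .$$
   Context: The Fourier transform is $\widehat f(\xi)=\int_{\mathbb{R}^n}e^{-2\pi i x\cdot\xi}f(x)\,dx$, with inverse $g^\vee(x)=\int_{\mathbb{R}^n}e^{2\pi i x\cdot\xi}g(\xi)\,d\xi$, and $m(-\Delta)f:=\big(m(4\pi^2|\cdot|^2)\widehat f\,\big)^\vee$; thus $\sqrt{-\Delta}$ has Fourier multiplier $2\pi|\xi|$. The Bessel potential space $H^s(\mathbb{R}^n)=(1-\Delta)^{-s/2}L^2(\mathbb{R}^n)$ has norm $\|f\|_{H^s}=\|(1-\Delta)^{s/2}f\|_{L^2}$. Measures $\mu$ are positive, compactly supported Borel measures on $\mathbb{R}^n$ with $$[\mu]_\alpha:=\sup_{x\in\mathbb{R}^n,\,r>0}\frac{\mu(B(x,r))}{r^\alpha}<\infty .$$ Definition of $\gamma_n(\alpha)$: it is the supremum of those $\gamma\ge 0$ such that, for some $p>1$, $$\Big(\int_0^1\int |u(x,t)|^p\,d\mu(x)\,dt\Big)^{1/p}\le C\,[\mu]_\alpha^{1/p}\,\|u_0\|_{H^{\frac{n-\alpha}{2}-\gamma}(\mathbb{R}^n)}$$ whenever $u_0$ and $\mu$ are real and even (i.e. $u_0(-x)=u_0(x)$, and $\mu$ is invariant under $x\mapsto -x$, with $[\mu]_\alpha<\infty$), where $u(x,t):=\cos\big(t\sqrt{-\Delta}-\tfrac{n-1}{4}\pi\big)u_0(x)$. The constant $C$ is independent of $u_0$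 and may depend on $\mu$ only through the diameter of the support of $\mu$ (it may also depend on $n,\alpha,p,\gamma$). The inequality is understood a priori for Schwartz $u_0$ (and extended by density). *)

(* Defs.v *)
From HB Require Import structures.
From mathcomp Require Import all_boot all_order all_algebra.
From mathcomp Require Import all_classical all_reals all_analysis.
From mathcomp Require Import measurable_realfun complex.

Set Implicit Arguments.
Unset Strict Implicit.
Unset Printing Implicit Defensive.

Import Order.TTheory GRing.Theory Num.Theory.
Import numFieldNormedType.Exports.

Local Open Scope classical_set_scope.
Local Open Scope ring_scope.
Local Open Scope complex_scope.

Definition mx_borel_display : measure_display.
Proof. exact. Qed.

(* R^n is 'rV[R]_n, with the topology of the library and its Borel
   sigma-algebra. *)
HB.instance Definition _ (R : realType) (m n : nat) :=
  @isMeasurable.Build mx_borel_display 'M[R]_(m, n) <<s @open 'M[R]_(m, n) >>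
    (@sigma_algebra0 _ setT (@open 'M[R]_(m, n))) (@sigma_algebraC _ _)
    (@sigma_algebra_bigcup _ setT _).

Lemma measurable_mx_coord (R : realType) (m n : nat) (i : 'I_m) (j : 'I_n) :
  measurable_fun setT (fun M : 'M[R]_(m, n) => M i j).
Proof.
apply: (measurability _ (RGenOpens.measurableE R)).
move=> _ [_ [a [b ->] <-]]; rewrite setTI; apply: sub_sigma_algebra.
apply: open_comp => [M _|]; [exact: coord_continuous | exact: interval_open].
Qed.

Lemma measurable_fun_mx d (T : measurableType d) (R : realType) (m n : nat)
    (f : T -> 'M[R]_(m, n)) :
  (forall i j, measurable_fun setT (fun t => f t i j)) -> measurable_fun setT f.
Proof.
move=> mf; apply: (@measurability _ _ _ _ setT f (@open _) erefl).
move=> _ [U oU <-]; rewrite setTI.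
pose q (a : 'M[rat]_(m, n) * rat) : set 'M[R]_(m, n) :=
  [set M | forall i j, `|ratr (a.1 i j) - M i j| < ratr a.2].
have -> : U = \bigcup_(a in [set a | q a `<=` U]) q a.
  apply/seteqP; split=> [M UM|M [a /= aU /aU]//].
  have /nbhs_ballP [e /= e0 eU] : nbhs M U by rewrite nbhsE/=; exists U.
  have /rat_in_itvoo [r /andP[]] : 0 < e / 2 by rewrite divr_gt0.
  rewrite bnd_simp => r0 re; rewrite bnd_simp in re.
  have h i j : exists s : rat, `|ratr s - M i j| < ratr r.
    have /rat_in_itvoo [s] : M i j - ratr r < M i j + ratr r.
      by rewrite ltrD2l gtrN.
    by rewrite in_itv/= => /andP[s1 s2]; exists s; rewrite ltr_distl s1 s2.
  pose A := \matrix_(i, j) xchoose (h i j).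
  have AM i j : `|ratr (A i j) - M i j| < ratr r.
    by rewrite mxE; exact: (xchooseP (h i j)).
  exists (A, r); last by move=> i j; exact: AM.
  move=> N /= AN; apply: eU; split => // i j; rewrite /ball/=.
  rewrite (splitr e) (le_lt_trans (ler_distD (ratr (A i j)) _ _))//.
  by rewrite ltrD// (lt_trans _ re)// 1?distrC.
rewrite preimage_bigcup bigcup_mkcond.
apply: countable_bigcupT_measurable => // a; case: ifP => // _.
have -> : f @^-1` q a =
    \bigcap_i \bigcap_j [set t | `|ratr (a.1 i j) - f t i j| < ratr a.2].
  apply/seteqP; split=> [t qt i _ j _|t qt i j]; first exact: qt.
  exact: (qt i I j I).
apply: fin_bigcap_measurable => // i _; apply: fin_bigcap_measurable => // j _.
rewrite -[X in measurable X]setTI.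
have mg : measurable_fun setT (fun t => `|ratr (a.1 i j) - f t i j|).
  by apply: measurableT_comp => //; apply: measurable_funB.
have := mg measurableT `]-oo, (ratr a.2)[%classic (measurable_itv _).
by congr (measurable _); apply/seteqP; split=> t /=; rewrite in_itv.
Qed.

(* Lebesgue measure on R^n, by recursion on n: the product of the Lebesgue
   measures on R and on R^(n-1), carried to R^n by (a, x) |-> row_mx a x. *)
Section lebesgue_rV.
Context {R : realType}.

Definition row_cons n (p : measurableTypeR R * 'rV[R]_n) : 'rV[R]_n.+1 :=
  row_mx (p.1)%:M p.2.

Lemma measurable_row_cons n : measurable_fun setT (@row_cons n).
Proof.
apply: measurable_fun_mx => i j; rewrite (ord1 i).
rewrite [X in measurable_fun _ X](_ : _ = fun p : measurableTypeR R * 'rV[R]_n =>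
    match fintype.split (j : 'I_(1 + n)) with inl _ => p.1 | inr k => p.2 0 k end).
  case: fintype.split => [_|k]; first exact: measurable_fst.
  exact: (measurableT_comp (measurable_mx_coord _ _) measurable_snd).
apply/funext => p; rewrite /row_cons mxE; case: fintype.split => // k.
by rewrite (ord1 k) mxE.
Qed.

Section lebesgue_step.
Variables (n : nat) (mu : {sigma_finite_measure set 'rV[R]_n -> \bar R}).

Definition lebesgue_step : set 'rV[R]_n.+1 -> \bar R :=
  pushforward (@lebesgue_measure R \x mu)%E (@row_cons n).

Let lebesgue_step0 : lebesgue_step set0 = 0%E.
Proof. by rewrite /lebesgue_step /pushforward preimage_set0 measure0. Qed.

Let lebesgue_step_ge0 A : (0 <= lebesgue_step A)%E.
Proof. by rewrite /lebesgue_step /pushforward; exact: measure_ge0. Qed.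

Let lebesgue_step_sigma_additive : semi_sigma_additive lebesgue_step.
Proof.
move=> F mF tF mUF; rewrite /lebesgue_step /pushforward preimage_bigcup.
have mP A : measurable A -> measurable (@row_cons n @^-1` A).
  by move=> mA; rewrite -[X in measurable X]setTI; exact: measurable_row_cons.
apply: measure_semi_sigma_additive.
- by move=> k; exact: mP.
- apply/trivIsetP => /= i j _ _ ij; rewrite -preimage_setI.
  by move/trivIsetP : tF => /(_ _ _ _ _ ij) ->//; rewrite preimage_set0.
- by rewrite -preimage_bigcup; exact: mP.
Qed.

HB.instance Definition _ := isMeasure.Build _ _ _ lebesgue_step
  lebesgue_step0 lebesgue_step_ge0 lebesgue_step_sigma_additive.

Let lebesgue_step_sigma_finite : sigma_finite setT lebesgue_step.
Proof.
have /sigma_finiteP[F [FT ndF Foo]] := sigma_finiteT (@lebesgue_measure R).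
have /sigma_finiteP[G [GT ndG Goo]] := sigma_finiteT mu.
pose g (x : 'rV[R]_n.+1) : measurableTypeR R * 'rV[R]_n :=
  (x 0 0, \row_j x 0 (lift 0 j)).
have mg : measurable_fun setT g.
  apply/measurable_fun_pairP; split; first exact: measurable_mx_coord.
  apply: measurable_fun_mx => i j /=.
  rewrite [X in measurable_fun _ X](_ : _ = fun x : 'rV[R]_n.+1 =>
    x 0 (lift 0 j)); first exact: measurable_mx_coord.
  by apply/funext => x /=; rewrite mxE.
have gK p : g (row_cons p) = p.
  case: p => a x; rewrite /g /row_cons; congr pair.
    rewrite mxE; case: fintype.splitP => [i _|k] //=.
    by rewrite ord1 mxE eqxx mulr1n.
  apply/rowP => j; rewrite mxE mxE; case: fintype.splitP => [i|k]/=.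
    by rewrite (ord1 i).
  by rewrite /bump/= !add1n => -[/ord_inj->].
exists (fun k => g @^-1` (F k `*` G k)).
  apply/seteqP; split=> // x _.
  have [k _ Fk] : (\bigcup_i F i) (g x).1 by rewrite -FT.
  have [l _ Gl] : (\bigcup_i G i) (g x).2 by rewrite -GT.
  exists (maxn k l) => //; split.
    by move: Fk; apply/subsetPset/ndF/leq_maxl.
  by move: Gl; apply/subsetPset/ndG/leq_maxr.
move=> k; have [mF Fk] := Foo k; have [mG Gk] := Goo k; split.
  by rewrite -[X in measurable X]setTI; apply: mg => //; exact: measurableX.
rewrite /lebesgue_step /pushforward.
have -> : row_cons (n:=n) @^-1` (g @^-1` (F k `*` G k)) = F k `*` G k.
  by rewrite -comp_preimage (_ : g \o _ = id)//; apply/funext => p; exact: gK.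
by rewrite product_measure1E// lte_mul_pinfty// ge0_fin_numE.
Qed.

HB.instance Definition _ := @Measure_isSigmaFinite.Build _ _ _ lebesgue_step
  lebesgue_step_sigma_finite.

End lebesgue_step.

Fixpoint lebesgue_rV n : {sigma_finite_measure set 'rV[R]_n -> \bar R} :=
  match n with
  | 0%N => \d_(0 : 'rV[R]_0)
  | k.+1 => lebesgue_step (lebesgue_rV k)
  end.

End lebesgue_rV.

Section euclidean.
Context {R : realType} {n : nat}.
Implicit Types x y : 'rV[R]_n.

Definition dotv x y : R := \sum_i x 0 i * y 0 i.

(* The norm `|x| of the library on 'rV[R]_n is the sup norm. *)
Definition enorm x : R := Num.sqrt (dotv x x).

Definition eball x (r : R) : set 'rV[R]_n := [set y | enorm (y - x) < r].

Definition diameter (A : set 'rV[R]_n) : R :=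
  sup [set enorm (xy.1 - xy.2) | xy in A `*` A].

(* Iterated partial derivatives along the coordinates listed in s. *)
Definition partials (s : seq 'I_n) (f : 'rV[R]_n -> R) : 'rV[R]_n -> R :=
  foldr (fun i g => 'D_(delta_mx 0 i) g) f s.

Definition schwartz (f : 'rV[R]_n -> R) : Prop :=
  forall s : seq 'I_n,
    (forall x, differentiable (partials s f) x) /\
    (forall k : nat, exists M : R,
       forall x, enorm x ^+ k * `|partials s f x| <= M).

End euclidean.

Section fourier.
Context {R : realType}.

Definition normC (z : R[i]) : R := complex.Re `|z|.

Definition expi (theta : R) : R[i] := cos theta +i* sin theta.

Definition Cintegral d (T : measurableType d) (mu : {measure set T -> \bar R})
    (f : T -> R[i]) : R[i] :=
  (\int[mu]_(x in setT) complex.Re (f x)) +i*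
  (\int[mu]_(x in setT) complex.Im (f x)).

Context {n : nat}.

Definition fourier (f : 'rV[R]_n -> R[i]) (xi : 'rV[R]_n) : R[i] :=
  Cintegral (lebesgue_rV n) (fun x => expi (- (2 * pi * dotv x xi)) * f x).

Definition inv_fourier (g : 'rV[R]_n -> R[i]) (x : 'rV[R]_n) : R[i] :=
  Cintegral (lebesgue_rV n) (fun xi => expi (2 * pi * dotv x xi) * g xi).

(* m(-Delta) f: with the 2 pi normalization of the Fourier transform, -Delta
   has symbol 4 pi^2 |xi|^2. *)
Definition multiplier (m : R -> R) (f : 'rV[R]_n -> R) : 'rV[R]_n -> R[i] :=
  inv_fourier (fun xi =>
    (m (4 * pi ^+ 2 * enorm xi ^+ 2))%:C * fourier (fun x => (f x)%:C) xi).

(* || (1 - Delta)^(s/2) f ||_(L^2) *)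
Definition sobolev_norm (s : R) (f : 'rV[R]_n -> R) : \bar R :=
  Lnorm (lebesgue_rV n) 2%:E
    (fun x => (normC (multiplier (fun l => (1 + l) `^ (s / 2)) f x))%:E).

(* cos(t sqrt(-Delta) - (n-1) pi / 4) u0 *)
Definition wave (u0 : 'rV[R]_n -> R) (x : 'rV[R]_n) (t : R) : R[i] :=
  multiplier (fun l => cos (t * Num.sqrt l - (n%:R - 1) / 4 * pi)) u0 x.

End fourier.

Section fractal.
Context {R : realType} {n : nat}.
Implicit Types mu : {measure set 'rV[R]_n -> \bar R}.

Definition msupport mu : set 'rV[R]_n :=
  [set x | forall U : set 'rV[R]_n, open U -> U x -> (0 < mu U)%E].

(* [mu]_alpha *)
Definition ball_growth (alpha : R) mu : \bar R :=
  ereal_sup [set (mu (eball xr.1 xr.2) / (xr.2 `^ alpha)%:E)%E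
            | xr in [set xr : 'rV[R]_n * R | 0 < xr.2]].

Definition even_measure mu : Prop :=
  forall A : set 'rV[R]_n, measurable A -> mu (-%R @^-1` A) = mu A.

(* The constant is a function of the diameter of the support of mu. *)
Definition wave_estimate (alpha gamma p : R) : Prop :=
  exists C : R -> R,
    forall (u0 : 'rV[R]_n -> R) (mu : {measure set 'rV[R]_n -> \bar R}),
      schwartz u0 -> (forall x, u0 (- x) = u0 x) ->
      compact (msupport mu) -> even_measure mu ->
      (ball_growth alpha mu < +oo)%E ->
      ((\int[lebesgue_measure]_(t in `[0%R, 1%R])
          \int[mu]_x (normC (wave u0 x t) `^ p)%:E) `^ p^-1
       <= (C (diameter (msupport mu)))%:E * ball_growth alpha mu `^ p^-1
          * sobolev_norm ((n%:R - alpha) / 2 - gamma) u0)%E.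

End fractal.

(* Equals -oo when no exponent gamma is admissible. *)
Definition gamma_sup (R : realType) (n : nat) (alpha : R) : \bar R :=
  ereal_sup [set gamma%:E | gamma in [set gamma : R |
    0 <= gamma /\ exists p : R, 1 < p /\ @wave_estimate R n alpha gamma p]].

(* Main.v *)
From HB Require Import structures.
Require Import Defs.
From mathcomp Require Import all_boot all_order all_algebra.
From mathcomp Require Import all_classical all_reals all_analysis.
From mathcomp Require Import measurable_realfun complex ring lra.
Import Order.TTheory GRing.Theory Num.Theory.
Import numFieldNormedType.Exports.
Local Open Scope classical_set_scope.
Local Open Scope ring_scope.
Set Implicit Arguments.
Unset Strict Implicit.
Unset Printing Implicit Defensive.

(** Every exponent that is admissible for alpha = 1/N is at most 1/2 + 1/N,
    because a solution can focus at the origin at a fixed proportion of the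
    times in [0, 1] although its Sobolev norm is small; letting N tend to
    infinity gives the bound 1/2.

    The initial datum has Fourier transform g(xi) = |xi|^(2k) e^(-pi |xi|^2),
    for k large; it is a polynomial times a Gaussian ([realizable_radgau]). Under
    the positive density g, the variable pi |xi|^2 follows a Gamma law of shape
    k + n/2, so the mass A of g sits at distance O(1) from the sphere of radius r,
    where r^2 = (k + n/2) / pi. If |x| r and t are at most 1/64, the phases of
    the integral defining u(x, t) are therefore almost constant, and
    u(x, t) = cos (2 pi r t - (n-1) pi / 4) A up to an error A / 4
    ([wave_integral_close]). The cosine is at least 1/2 in absolute value for a
    fixed proportion of the times ([large_cos_measure]). The measure mu is the
    image of Lebesgue measure on [0, 1] under u |-> u^N, put symmetrically on a
    coordinate axis: it has dimension 1/N ([ball_growth_axis_measure]) and gives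
    the ball of radius 1/(64 r) a mass of order r^(-1/N)
    ([axis_measure_segment]). As p > 1, the left-hand side of the estimate is at
    least a constant times A r^(-1/N).

    For the right-hand side, Plancherel's inequality ([plancherel_le]) bounds the
    Sobolev norm of order s by r^(max(s, 0)) times the L^2 norm of g, up to a
    constant ([weighted_integral_le]). The recursion for the moments of Gamma
    laws gives |g|_1^2 / |g|_2^2 >= c r^(n-1) ([spread_ge]). Hence
    (n-1)/2 <= max(s, 0) + 1/N ([gamma_le]), and s = (n - 1/N)/2 - gamma. *)

(** * Real-valued integrals *)
Notation intble mu f := (mu.-integrable setT (EFin \o f)).

Section integrable_functions.
Context d (T : measurableType d) (R : realType).
Variable mu : {measure set T -> \bar R}.
Implicit Types f g : T -> R.

Lemma intble_measurable f : intble mu f -> measurable_fun setT f.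
Proof. by move/measurable_int/measurable_EFinP. Qed.

Lemma intble_le f g : measurable_fun setT f -> (forall x, `|f x| <= g x) ->
  intble mu g -> intble mu f.
Proof.
move=> mf fg ig; apply: le_integrable ig => //; first exact/measurable_EFinP.
by move=> x _; rewrite /= lee_fin (le_trans (fg x)) ?ler_norm.
Qed.

Lemma intbleD f g : intble mu f -> intble mu g ->
  intble mu (fun x => f x + g x).
Proof. by move=> /integrableD H /H; apply. Qed.

Lemma intbleB f g : intble mu f -> intble mu g ->
  intble mu (fun x => f x - g x).
Proof. by move=> fi gi; exact: (integrableB measurableT fi gi). Qed.

Lemma intbleZ f k : intble mu f -> intble mu (fun x => k * f x).
Proof. by move=> fi; exact: (integrableZl measurableT k fi). Qed.

Lemma intble_sum (I : Type) (r : seq I) (F : I -> T -> R) :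
  (forall i, intble mu (F i)) -> intble mu (fun x => \sum_(i <- r) F i x).
Proof.
move=> iF; elim: r => [|i r IH].
  rewrite (_ : EFin \o _ = fun=> 0%E); first exact: integrable0.
  by apply/funext => x; rewrite /= big_nil.
rewrite (_ : EFin \o _ = EFin \o fun x => F i x + \sum_(j <- r) F j x).
  exact: intbleD.
by apply/funext => x; rewrite /= big_cons.
Qed.

Lemma Rintegral_sum (I : Type) (r : seq I) (F : I -> T -> R) :
  (forall i, intble mu (F i)) ->
  \int[mu]_x (\sum_(i <- r) F i x) = \sum_(i <- r) \int[mu]_x F i x.
Proof.
move=> iF; elim: r => [|i r IH].
  rewrite big_nil (_ : (fun=> _) = cst (0 : R)).
    by rewrite /Rintegral integral0.
  by apply/funext => x; rewrite big_nil.
rewrite big_cons -IH -RintegralD//; last exact: intble_sum.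
by apply: eq_Rintegral => x _; rewrite big_cons.
Qed.

Lemma eq_intble f g : f =1 g -> intble mu f -> intble mu g.
Proof. by move=> /funext ->. Qed.

Lemma EFin_Rintegral f : intble mu f ->
  ((\int[mu]_x f x)%:E = \int[mu]_x (f x)%:E)%E.
Proof. by move=> fi; rewrite /Rintegral fineK//; exact: integrable_fin_num. Qed.

End integrable_functions.

(** * Integration on the line and Gaussians *)
Section integral_line.
Context {R : realType}.
Notation leb := (@lebesgue_measure R).

Lemma is_derive_continuous (F f : R -> R) :
  (forall x : R, is_derive x 1 F (f x)) -> continuous F.
Proof.
move=> dF x; apply/differentiable_continuous/derivable1_diffP.
by case: (dF x).
Qed.

(** Integration by parts on the whole line is used in this form: it is the
    fundamental theorem on [- k, k], in the limit k -> oo by dominated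
    convergence.  The boundary term only needs to vanish along integers. *)
Lemma integral_derive_eq0 (F f : R -> R) :
  (forall x : R, is_derive x 1 F (f x)) -> continuous f -> intble leb f ->
  F k%:R - F (- k%:R) @[k --> \oo] --> 0 -> \int[leb]_x f x = 0.
Proof.
move=> dF cf fi F0.
have cF := is_derive_continuous dF.
pose D (k : nat) : set R := `[- k%:R, k%:R]%classic.
have mf := intble_measurable fi.
have [] := @dominated_convergence _ _ _ leb setT measurableT
  (fun k => EFin \o (f \_ (D k))) (EFin \o f) (EFin \o (fun x => `|f x|)).
- move=> k; apply/measurable_EFinP/(measurable_restrictT _ _).1.
    exact: measurable_itv.
  exact: measurable_funTS.
- exact/measurable_EFinP.
- apply: aeW => x _; apply: cvg_near_cst.
  near=> k; rewrite /= patchE ifT//; apply/mem_set.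
  rewrite /D/= in_itv/= -ler_norml.
  by near: k; exact: nbhs_infty_ger.
- exact: integrable_norm.
- apply: aeW => x k _; rewrite /= lee_fin patchE.
  by case: ifP => _ //; rewrite normr0.
- move=> _ _ cvf.
have -> : \int[leb]_x f x = limn (fun k => \int[leb]_x (f \_ (D k)) x).
  apply/esym/cvg_lim => //; rewrite /Rintegral; apply: fine_cvg.
  by rewrite fineK//; exact: integrable_fin_num.
apply/cvg_lim => //; apply: cvg_trans F0; apply: near_eq_cvg.
near=> k; rewrite -Rintegral_mkcond /Rintegral.
have k0 : - (k%:R : R) < k%:R by rewrite gtrN// ltr0n; near: k; exact: nbhs_infty_gt.
rewrite (@continuous_FTC2 _ f F)//.
- exact: continuous_subspaceT.
- split.
  + by move=> x _; case: (dF x).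
  + exact/cvg_at_right_filter/cF.
  + exact/cvg_at_left_filter/cF.
- by move=> x _; rewrite derive1E; have [_ ->] := dF x.
Unshelve. all: end_near.
Qed.

Definition gau (a x : R) : R := expR (- (a * x ^+ 2)).

Lemma gau_ge0 a x : 0 <= gau a x. Proof. exact: expR_ge0. Qed.

Lemma is_derive_gau a (x : R) : is_derive x 1 (gau a) (- (2 * a * x) * gau a x).
Proof.
have -> : gau a = expR \o (fun y => - (a *: (y ^+ 2))) by [].
apply: is_derive_eq; rewrite /gau/=.
by rewrite /GRing.scale/=; ring.
Qed.

Lemma continuous_gau a : continuous (gau a).
Proof. by apply: is_derive_continuous => x; exact: is_derive_gau. Qed.

Lemma measurable_gau a : measurable_fun setT (gau a).
Proof. by apply: continuous_measurable_fun; exact: continuous_gau. Qed.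

(** Integrability and total mass of Gaussians come from the normal law of
    variance 1/(2a). *)
Lemma gau_normal a m x : 0 < a ->
  gau a (x - m) = Num.sqrt (pi / a) * normal_pdf m (Num.sqrt (2 * a))^-1 x.
Proof.
move=> a0.
have s0 : (Num.sqrt (2 * a))^-1 != 0 by rewrite invr_neq0// gt_eqF// sqrtr_gt0 mulr_gt0.
rewrite normal_pdfE// /normal_peak /normal_fun exprVn sqr_sqrtr ?mulr_ge0 ?ltW//.
rewrite (_ : (2 * a)^-1 * pi *+ 2 = pi / a); last by field; rewrite gt_eqF.
rewrite mulrA divff ?mul1r; last by rewrite gt_eqF// sqrtr_gt0 divr_gt0 ?pi_gt0.
by rewrite /gau; congr expR; field; rewrite gt_eqF.
Qed.

Lemma intble_gau_shift a m : 0 < a -> intble leb (fun x => gau a (x - m)).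
Proof.
move=> a0; under eq_fun do rewrite gau_normal//.
exact/intbleZ/integrable_normal_pdf.
Qed.

Lemma integral_gau_shift a m : 0 < a ->
  \int[leb]_x gau a (x - m) = Num.sqrt (pi / a).
Proof.
move=> a0; under eq_Rintegral do rewrite gau_normal//.
rewrite RintegralZl//; last exact: integrable_normal_pdf.
by rewrite /Rintegral integral_normal_pdf mulr1.
Qed.

Lemma intble_gau a : 0 < a -> intble leb (gau a).
Proof.
by move=> /(intble_gau_shift 0); apply: eq_intble => x; rewrite subr0.
Qed.

Lemma integral_gau a : 0 < a -> \int[leb]_x gau a x = Num.sqrt (pi / a).
Proof.
move=> /(integral_gau_shift 0) <-; apply: eq_Rintegral => x _.
by rewrite subr0.
Qed.

End integral_line.

(** * Polynomials times Gaussians on the line *)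
Section gaussian_moments.
Context {R : realType}.
Notation leb := (@lebesgue_measure R).
Implicit Types (p : {poly R}) (a b x : R).

(** By Horner's scheme, it suffices that |x| e^(b x^2 / 2) is dominated by
    e^(b x^2), up to a constant. *)
Lemma poly_le_expR p b : 0 < b ->
  exists2 C : R, 0 <= C & forall x, `|p.[x]| <= C * expR (b * x ^+ 2).
Proof.
elim/poly_ind: p b => [|p c IH] b b0.
  exists 0; first exact: lexx.
  by move=> x; rewrite horner0 normr0 mul0r.
have [C C0 HC] := IH (b / 2) ltac:(by rewrite divr_gt0).
exists (C * (1 + 2 / b) + `|c|) => [|x].
  by rewrite addr_ge0// mulr_ge0// addr_ge0// divr_ge0// ltW.
rewrite hornerMXaddC (le_trans (ler_normD _ _))// mulrDl lerD//; last first.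
  by rewrite ler_peMr// -expR0 ler_expR mulr_ge0 ?sqr_ge0 ?ltW//.
rewrite normrM (_ : b * x ^+ 2 = b / 2 * x ^+ 2 + b / 2 * x ^+ 2); last by field.
rewrite expRD mulrACA ler_pM//.
have h1 : `|x| <= 1 + x ^+ 2.
  by have := sqr_ge0 (`|x| - 1); have := sqr_ge0 `|x|; rewrite -(real_normK (num_real x)); nra.
apply: (le_trans h1); apply: (@le_trans _ _ ((1 + 2 / b) * (1 + b / 2 * x ^+ 2))).
  have -> : (1 + 2 / b) * (1 + b / 2 * x ^+ 2) =
    (1 + x ^+ 2) + (2 / b + b / 2 * x ^+ 2) by field; rewrite gt_eqF.
  rewrite lerDl; apply: addr_ge0; last by rewrite mulr_ge0 ?sqr_ge0 ?divr_ge0 ?ltW.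
  by rewrite divr_ge0 ?ltW.
by rewrite ler_wpM2l ?expR_ge1Dx// addr_ge0 ?divr_ge0 ?ltW.
Qed.

Lemma poly_gau_le p a : 0 < a ->
  exists2 C : R, 0 <= C & forall x, `|p.[x] * gau a x| <= C * gau (a / 2) x.
Proof.
move=> a0; have [|C C0 HC] := @poly_le_expR p (a / 2); first by rewrite divr_gt0.
exists C => // x; rewrite normrM (ger0_norm (gau_ge0 _ _)).
apply: (le_trans (ler_wpM2r (gau_ge0 _ _) (HC x))).
rewrite -[leLHS]mulrA /gau -expRD; apply/ler_wpM2l => //; rewrite ler_expR le_eqVlt.
by apply/orP; left; apply/eqP; field.
Qed.

Lemma intble_poly_gauM p a (h : R -> R) : 0 < a -> measurable_fun setT h ->
  (forall x, `|h x| <= 1) -> intble leb (fun x => p.[x] * gau a x * h x).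
Proof.
move=> a0 mh h1; have [C C0 HC] := poly_gau_le p a0.
apply: (@intble_le _ _ _ leb _ (fun x => C * gau (a / 2) x)).
- apply: measurable_funM => //; apply: measurable_funM.
    exact: measurable_poly.
  exact: measurable_gau.
- by move=> x; rewrite normrM (le_trans _ (HC x))// ler_piMr.
- by apply: intbleZ; apply: intble_gau; rewrite divr_gt0.
Qed.

Lemma intble_poly_gau p a : 0 < a -> intble leb (fun x => p.[x] * gau a x).
Proof.
move=> a0; apply: eq_intble (@intble_poly_gauM p a (cst 1) a0 _ _).
- by move=> x /=; rewrite mulr1.
- exact: measurable_cst.
- by move=> x; rewrite normr1.
Qed.

(** The boundary term in [integral_derive_eq0]: the bound for (1 + X^2) p
    instead of p gives decay. *)
Lemma poly_gauM_cvg0 p a (h : R -> R) : 0 < a -> (forall x, `|h x| <= 1) ->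
  (fun x => p.[x] * gau a x * h x) k%:R -
  (fun x => p.[x] * gau a x * h x) (- k%:R) @[k --> \oo] --> 0.
Proof.
move=> a0 h1; have [C C0 HC] := poly_gau_le (p * (1 + 'X ^+ 2)) a0.
have H x : `|p.[x] * gau a x * h x| <= C / (1 + x ^+ 2).
  have x0 : 0 < 1 + x ^+ 2 by rewrite ltr_pwDl// sqr_ge0.
  rewrite ler_pdivlMr// -{1}(ger0_norm (ltW x0)) -normrM.
  apply: (@le_trans _ _ `|(p * (1 + 'X ^+ 2)).[x] * gau a x|).
    rewrite [X in `|X| <= _](_ : _ = (p * (1 + 'X ^+ 2)).[x] * gau a x * h x).
      by rewrite normrM ler_piMr.
    by rewrite !hornerE; ring.
  rewrite (le_trans (HC x))// ler_piMr// -expR0 ler_expR oppr_le0.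
  by rewrite mulr_ge0 ?sqr_ge0// divr_ge0// ltW.
apply: (@squeeze_cvgr _ _ _ _ (fun k => - (2 * C * harmonic k)) (fun k => 2 * C * harmonic k)).
- near=> k; rewrite -ler_norml /harmonic/=.
  rewrite (le_trans (ler_normB _ _))// (_ : 2 * C * k.+1%:R^-1 = C / k.+1%:R + C / k.+1%:R); last by ring.
  have Hk : C / (1 + k%:R ^+ 2) <= C / k.+1%:R.
    have kk : k.+1%:R <= 1 + k%:R ^+ 2 :> R.
      rewrite -nat1r lerD2l -natrX ler_nat.
      by case: (k) => // m; rewrite -{1}(expn1 m.+1) leq_pexp2l.
    by rewrite ler_wpM2l// lef_pV2 ?posrE// (lt_le_trans _ kk).
  by rewrite lerD// (le_trans (H _))// sqrrN.
- rewrite -oppr0; apply: cvgN; rewrite -[X in _ --> X](mulr0 (2 * C)).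
  by apply: cvgM; [exact: cvg_cst|exact: cvg_harmonic].
- rewrite -[X in _ --> X](mulr0 (2 * C)).
  by apply: cvgM; [exact: cvg_cst|exact: cvg_harmonic].
Unshelve. all: end_near.
Qed.

(** The action of d/dx on p, when p stands for the function p(x) e^(-a x^2). *)
Definition pgder a p : {poly R} := p^`() - (2 * a) *: ('X * p).

Lemma is_derive_poly_gau p a (x : R) :
  is_derive x 1 (fun y => p.[y] * gau a y) ((pgder a p).[x] * gau a x).
Proof.
have := is_deriveM (is_derive_poly p x) (is_derive_gau a x).
move=> /is_derive_eq; apply.
by rewrite /pgder !hornerE /GRing.scale/=; ring.
Qed.

Lemma is_derive_cosM b (x : R) : is_derive x 1 (fun y => cos (b * y)) (- (b * sin (b * x))).
Proof.
have := @is_derive1_comp R cos (fun y => b *: y) x _ _ (is_derive_cos _) (@is_deriveZ _ _ _ id b x 1 1 (is_derive_id _ _)).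
by move=> /is_derive_eq; apply; rewrite /GRing.scale/=; ring.
Qed.

Lemma is_derive_sinM b (x : R) : is_derive x 1 (fun y => sin (b * y)) (b * cos (b * x)).
Proof.
have := @is_derive1_comp R sin (fun y => b *: y) x _ _ (is_derive_sin _) (@is_deriveZ _ _ _ id b x 1 1 (is_derive_id _ _)).
by move=> /is_derive_eq; apply; rewrite /GRing.scale/=; ring.
Qed.

Lemma measurable_cosM b : measurable_fun setT (fun x : R => cos (b * x)).
Proof.
by apply: continuous_measurable_fun; apply: is_derive_continuous => x; exact: is_derive_cosM.
Qed.

Lemma measurable_sinM b : measurable_fun setT (fun x : R => sin (b * x)).
Proof.
by apply: continuous_measurable_fun; apply: is_derive_continuous => x; exact: is_derive_sinM.
Qed.

Lemma ler_norm_cos x : `|cos x| <= 1.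
Proof. by rewrite ler_norml cos_geN1 cos_le1. Qed.

Lemma ler_norm_sin x : `|sin x| <= 1.
Proof. by rewrite ler_norml sin_geN1 sin_le1. Qed.

(** Real and imaginary parts of the Fourier transform of p(x) e^(-a x^2), at
    the angular frequency b and up to the sign of the latter. *)
Definition gcos a p b := \int[leb]_x (p.[x] * gau a x * cos (b * x)).
Definition gsin a p b := \int[leb]_x (p.[x] * gau a x * sin (b * x)).

Lemma intble_gcos a p b : 0 < a -> intble leb (fun x => p.[x] * gau a x * cos (b * x)).
Proof.
move=> a0; apply: intble_poly_gauM => //; first exact: measurable_cosM.
by move=> x; exact: ler_norm_cos.
Qed.

Lemma intble_gsin a p b : 0 < a -> intble leb (fun x => p.[x] * gau a x * sin (b * x)).
Proof.
move=> a0; apply: intble_poly_gauM => //; first exact: measurable_sinM.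
by move=> x; exact: ler_norm_sin.
Qed.

(** Derivation becomes multiplication by the frequency. *)
Lemma gcos_pgder a p b : 0 < a -> gcos a (pgder a p) b = b * gsin a p b.
Proof.
move=> a0; apply/eqP; rewrite -subr_eq0; apply/eqP.
rewrite /gcos /gsin -RintegralZl//; last exact: intble_gsin.
rewrite -RintegralB//; [|exact: intble_gcos|exact/intbleZ/intble_gsin].
apply: (@integral_derive_eq0 _ (fun x => p.[x] * gau a x * cos (b * x))).
- move=> x; have := is_deriveM (is_derive_poly_gau p a x) (is_derive_cosM b x).
  by move=> /is_derive_eq; apply; rewrite /GRing.scale/=; ring.
- move=> x; apply: cvgB; (apply: cvgM; last first).
  + exact: (is_derive_continuous (is_derive_cosM b)).
  + exact: (is_derive_continuous (is_derive_poly_gau (pgder a p) a)).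
  + apply: cvgM; first exact: (is_derive_continuous (is_derive_poly_gau p a)).
    exact: (is_derive_continuous (is_derive_sinM b)).
  + exact: cvg_cst.
- apply: intbleB; first exact: intble_gcos.
  exact/intbleZ/intble_gsin.
- by apply: (@poly_gauM_cvg0 p a (fun x => cos (b * x)) a0) => x; exact: ler_norm_cos.
Qed.

Lemma gsin_pgder a p b : 0 < a -> gsin a (pgder a p) b = - (b * gcos a p b).
Proof.
move=> a0; apply/eqP; rewrite -subr_eq0 opprK; apply/eqP.
rewrite /gcos /gsin -RintegralZl//; last exact: intble_gcos.
rewrite -RintegralD//; [|exact: intble_gsin|exact/intbleZ/intble_gcos].
apply: (@integral_derive_eq0 _ (fun x => p.[x] * gau a x * sin (b * x))).
- move=> x; have := is_deriveM (is_derive_poly_gau p a x) (is_derive_sinM b x).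
  by move=> /is_derive_eq; apply; rewrite /GRing.scale/=; ring.
- move=> x; apply: cvgD; (apply: cvgM; last first).
  + exact: (is_derive_continuous (is_derive_sinM b)).
  + exact: (is_derive_continuous (is_derive_poly_gau (pgder a p) a)).
  + apply: cvgM; first exact: (is_derive_continuous (is_derive_poly_gau p a)).
    exact: (is_derive_continuous (is_derive_cosM b)).
  + exact: cvg_cst.
- apply: intbleD; first exact: intble_gsin.
  exact/intbleZ/intble_gcos.
- by apply: (@poly_gauM_cvg0 p a (fun x => sin (b * x)) a0) => x; exact: ler_norm_sin.
Qed.

End gaussian_moments.

(** * Fourier transforms and moments on the line *)
Section gaussian_fourier.
Context {R : realType}.
Notation leb := (@lebesgue_measure R).
Implicit Types (p : {poly R}) (a b x : R).

(** The Fourier transform of a Gaussian solves this equation, since derivation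
    in the frequency is multiplication by x, and x e^(-a x^2) is a derivative. *)
Lemma gaussian_ode a (F : R -> R) : 0 < a ->
  (forall b : R, is_derive b 1 F (- (b / (2 * a)) * F b)) ->
  forall b, F b = F 0 * gau (4 * a)^-1 b.
Proof.
move=> a0 dF b; pose H y := F y * gau (- (4 * a)^-1) y.
have dH (y : R) : is_derive y 1 H 0.
  have := is_deriveM (dF y) (is_derive_gau (- (4 * a)^-1) y).
  move=> /is_derive_eq; apply; rewrite /GRing.scale/=.
  by field; rewrite gt_eqF.
have := @is_derive_0_is_cst _ H b 0 dH; rewrite /H => HE.
have -> : F 0 = F b * gau (- (4 * a)^-1) b.
  by rewrite HE /gau expr0n/= mulr0 oppr0 expR0 mulr1.
by rewrite -mulrA /gau -expRD mulNr opprK addrN expR0 mulr1.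
Qed.


(** Differentiation under the integral sign, with the dominating function
    |x| e^(-a x^2), followed by [gsin_pgder]. *)
Lemma is_derive_gcos1 a b : 0 < a ->
  is_derive b 1 (gcos a 1) (- (b / (2 * a)) * gcos a 1 b).
Proof.
move=> a0.
pose f (c x : R) := (1 : {poly R}).[x] * gau a x * cos (c * x).
pose G (x : R) := `|'X.[x] * gau a x|.
have df (x c : R) : is_derive c 1 (f ^~ x) (- ('X.[x] * gau a x * sin (c * x))).
  have := is_derive_cosM x c.
  move=> /(@is_deriveZ _ _ _ _ (gau a x))/is_derive_eq H.
  have -> : f ^~ x = gau a x \*: (fun y => cos (x * y)).
    by apply/funext => y; rewrite /f/= hornerC mul1r mulrC mulrC [x * y]mulrC.
  by apply: H; rewrite /GRing.scale/= hornerX [x * c]mulrC; ring.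
have ab : b \in `](b - 1), (b + 1)[.
  by rewrite in_itv/= ltrBlDr !ltrDl ltr01.
have iG : intble leb G by exact/integrable_norm/intble_poly_gau.
have G_ub (c x : R) : c \in `](b - 1), (b + 1)[ -> setT x -> `|partial1of2 f c x| <= G x.
  move=> _ _; rewrite partial1of2E; have [_ ->] := df x c.
  by rewrite /G normrN [X in X <= _]normrM ler_piMr// ler_norm_sin.
have ix (c : R) : c \in `](b - 1), (b + 1)[ -> intble leb (f c).
  by move=> _; exact: intble_gcos.
have dx (c x : R) : c \in `](b - 1), (b + 1)[ -> setT x -> derivable (f ^~ x) c 1.
  by move=> _ _; have [] := df x c.
have G0 x : 0 <= G x by exact: normr_ge0.
apply: DeriveDef.
  exact: (derivable_under_integral measurableT ab ix dx G0 iG G_ub).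
rewrite -derive1E.
rewrite (differentiation_under_integral measurableT ab ix dx G0 iG G_ub).
transitivity ((2 * a)^-1 * gsin a (pgder a 1) b); last first.
  by rewrite gsin_pgder//; ring.
rewrite -RintegralZl//; last exact: intble_gsin.
apply: eq_Rintegral => x _; rewrite partial1of2E; have [_ ->] := df x b.
rewrite /pgder derivC sub0r hornerN hornerZ hornerM hornerX hornerC.
by field; rewrite gt_eqF.
Qed.

Lemma is_derive_gsin1 a b : 0 < a ->
  is_derive b 1 (gsin a 1) (- (b / (2 * a)) * gsin a 1 b).
Proof.
move=> a0.
pose f (c x : R) := (1 : {poly R}).[x] * gau a x * sin (c * x).
pose G (x : R) := `|'X.[x] * gau a x|.
have df (x c : R) : is_derive c 1 (f ^~ x) ('X.[x] * gau a x * cos (c * x)).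
  have := is_derive_sinM x c.
  move=> /(@is_deriveZ _ _ _ _ (gau a x))/is_derive_eq H.
  have -> : f ^~ x = gau a x \*: (fun y => sin (x * y)).
    by apply/funext => y; rewrite /f/= hornerC mul1r mulrC mulrC [x * y]mulrC.
  by apply: H; rewrite /GRing.scale/= hornerX [x * c]mulrC; ring.
have ab : b \in `](b - 1), (b + 1)[.
  by rewrite in_itv/= ltrBlDr !ltrDl ltr01.
have iG : intble leb G by exact/integrable_norm/intble_poly_gau.
have G_ub (c x : R) : c \in `](b - 1), (b + 1)[ -> setT x -> `|partial1of2 f c x| <= G x.
  move=> _ _; rewrite partial1of2E; have [_ ->] := df x c.
  by rewrite /G [X in X <= _]normrM ler_piMr// ler_norm_cos.
have ix (c : R) : c \in `](b - 1), (b + 1)[ -> intble leb (f c).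
  by move=> _; exact: intble_gsin.
have dx (c x : R) : c \in `](b - 1), (b + 1)[ -> setT x -> derivable (f ^~ x) c 1.
  by move=> _ _; have [] := df x c.
have G0 x : 0 <= G x by exact: normr_ge0.
apply: DeriveDef.
  exact: (derivable_under_integral measurableT ab ix dx G0 iG G_ub).
rewrite -derive1E.
rewrite (differentiation_under_integral measurableT ab ix dx G0 iG G_ub).
transitivity (- (2 * a)^-1 * gcos a (pgder a 1) b); last first.
  by rewrite gcos_pgder//; ring.
rewrite -RintegralZl//; last exact: intble_gcos.
apply: eq_Rintegral => x _; rewrite partial1of2E; have [_ ->] := df x b.
rewrite /pgder derivC sub0r hornerN hornerZ hornerM hornerX hornerC.
by field; rewrite gt_eqF.
Qed.

Lemma gcos1 a b : 0 < a -> gcos a 1 b = Num.sqrt (pi / a) * gau (4 * a)^-1 b.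
Proof.
move=> a0; rewrite (gaussian_ode a0 (fun b => is_derive_gcos1 b a0)).
rewrite -(integral_gau a0) /gcos; congr (_ * _).
by apply: eq_Rintegral => x _; rewrite mul0r cos0 hornerC mulr1 mul1r.
Qed.

(** The odd part satisfies the same equation, with initial value 0. *)
Lemma gsin1 a b : 0 < a -> gsin a 1 b = 0.
Proof.
move=> a0; rewrite (gaussian_ode a0 (fun b => is_derive_gsin1 b a0)).
rewrite /gsin (_ : (fun x => _) = cst 0); first by rewrite /Rintegral integral0/= mul0r.
by apply/funext => x; rewrite mul0r sin0 mulr0.
Qed.

(** Each step applies - (2 pi)^-2 d^2/dx^2, so that hermite m e^(-pi x^2) has
    Fourier transform xi^(2m) e^(-pi xi^2). *)
Fixpoint hermite (m : nat) : {poly R} :=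
  if m is k.+1 then - (4 * pi ^+ 2)^-1 *: pgder pi (pgder pi (hermite k)) else 1.

Lemma gcosZ a c p b : 0 < a -> gcos a (c *: p) b = c * gcos a p b.
Proof.
move=> a0; rewrite -RintegralZl//; last exact: intble_gcos.
by apply: eq_Rintegral => x _; rewrite hornerZ !mulrA.
Qed.

Lemma gsinZ a c p b : 0 < a -> gsin a (c *: p) b = c * gsin a p b.
Proof.
move=> a0; rewrite -RintegralZl//; last exact: intble_gsin.
by apply: eq_Rintegral => x _; rewrite hornerZ !mulrA.
Qed.

Lemma gcos_hermite m (xi : R) :
  gcos pi (hermite m) (2 * pi * xi) = xi ^+ (2 * m) * gau pi xi.
Proof.
have p0 : 0 < pi :> R by exact: pi_gt0.
elim: m => [|m IH] /=.
  rewrite gcos1// divff ?gt_eqF// sqrtr1 muln0 expr0 !mul1r /gau.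
  by congr expR; move: (pi : R) p0 => P P0; field; rewrite gt_eqF.
rewrite gcosZ// gcos_pgder// gsin_pgder// IH mulnS exprD.
by move: (gau pi xi) (pi : R) p0 {IH} => g P P0; field; rewrite gt_eqF.
Qed.

Lemma gsin_hermite m (xi : R) : gsin pi (hermite m) (2 * pi * xi) = 0.
Proof.
have p0 : 0 < pi :> R by exact: pi_gt0.
elim: m => [|m IH] /=; first exact: gsin1.
by rewrite gsinZ// gsin_pgder// gcos_pgder// IH !mulr0 oppr0 mulr0.
Qed.

(** [pgder] exchanges even and odd polynomials. *)
Lemma hermiteN m x : (hermite m).[- x] = (hermite m).[x].
Proof.
suff H : hermite m \Po - 'X = hermite m.
  by rewrite -{2}H horner_comp !hornerE.
elim: m => [|m IH] /=; first by rewrite comp_polyC.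
have odd_pgder p e : p \Po - 'X = e *: p -> pgder pi p \Po - 'X = - e *: pgder pi p.
  move=> pe; have := congr1 deriv pe.
  rewrite deriv_comp derivN derivX derivZ mulrN1 => /eqP.
  rewrite eqr_oppLR => /eqP dp.
  rewrite /pgder comp_polyB comp_polyZ comp_polyM comp_polyX pe dp.
  by rewrite -!mul_polyC polyCN; ring.
rewrite comp_polyZ (odd_pgder _ (-1)) ?opprK ?scale1r//.
by rewrite (odd_pgder _ 1) ?scale1r.
Qed.

Definition gmoment a m := \int[leb]_x (x ^+ (2 * m) * gau a x).

Lemma intble_gmoment a m : 0 < a -> intble leb (fun x => x ^+ (2 * m) * gau a x).
Proof.
move=> a0; apply: eq_intble (@intble_poly_gau _ ('X ^+ (2 * m)) a a0) => x.
by rewrite !hornerE.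
Qed.

(** The integral of (x^(2m+1) e^(-a x^2))' vanishes. *)
Lemma gmomentS a m : 0 < a ->
  gmoment a m.+1 = ((2 * m).+1%:R / (2 * a)) * gmoment a m.
Proof.
move=> a0; have := @gcos_pgder _ a 'X^((2 * m).+1) 0 a0; rewrite mul0r => H.
apply/esym/eqP; rewrite -subr_eq0; apply/eqP.
rewrite /gmoment -RintegralZl//; last exact: intble_gmoment.
rewrite -RintegralB//; [|exact/intbleZ/intble_gmoment|exact: intble_gmoment].
transitivity ((2 * a)^-1 * gcos a (pgder a 'X^((2 * m).+1)) 0); last by rewrite H mulr0.
rewrite -RintegralZl//; last exact: intble_gcos.
apply: eq_Rintegral => x _; rewrite mul0r cos0 /pgder derivXn/=.
rewrite hornerD hornerN hornerZ hornerM hornerMn !hornerXn hornerX.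
rewrite mulnS exprD expr2 [in RHS]exprS -(mulr_natr (x ^+ (2 * m))).
by field; rewrite gt_eqF.
Qed.

Lemma gmoment_gt0 a m : 0 < a -> 0 < gmoment a m.
Proof.
move=> a0; elim: m => [|m IH].
  have -> : gmoment a 0 = \int[leb]_x gau a x.
    by apply: eq_Rintegral => x _; rewrite muln0 expr0 mul1r.
  by rewrite integral_gau// sqrtr_gt0 divr_gt0 ?pi_gt0.
by rewrite gmomentS// mulr_gt0// divr_gt0 ?ltr0n ?mulr_gt0.
Qed.

End gaussian_fourier.

(** * Products of sigma-finite measures *)
Section product_integrals.
Context d1 d2 (T1 : measurableType d1) (T2 : measurableType d2) (R : realType).
Variables (m1 : {sigma_finite_measure set T1 -> \bar R})
          (m2 : {sigma_finite_measure set T2 -> \bar R}).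

(** The product of two sigma-finite measures, as a sigma-finite measure that can
    itself be a factor of a further product. *)
Definition sfprod : set (T1 * T2) -> \bar R := (m1 \x m2)%E.

HB.instance Definition _ := isMeasure.Build _ _ _ sfprod
  (measure0 (m1 \x m2)%E) (measure_ge0 (m1 \x m2)%E)
  (@measure_semi_sigma_additive _ _ _ (m1 \x m2)%E).

Lemma sfprod_sigma_finite : sigma_finite setT sfprod.
Proof.
have /sigma_finiteP[F [FT ndF Foo]] := sigma_finiteT m1.
have /sigma_finiteP[G [GT ndG Goo]] := sigma_finiteT m2.
exists (fun k => F k `*` G k).
  apply/seteqP; split=> // -[x y] _.
  have [k _ Fk] : (\bigcup_i F i) x by rewrite -FT.
  have [l _ Gl] : (\bigcup_i G i) y by rewrite -GT.
  exists (maxn k l) => //; split.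
    by move: Fk; apply/subsetPset/ndF/leq_maxl.
  by move: Gl; apply/subsetPset/ndG/leq_maxr.
move=> k; have [mF Fk] := Foo k; have [mG Gk] := Goo k; split.
  exact: measurableX.
by rewrite /sfprod product_measure1E// lte_mul_pinfty// ge0_fin_numE.
Qed.

HB.instance Definition _ :=
  Measure_isSigmaFinite.Build _ _ _ sfprod sfprod_sigma_finite.

Lemma measurable_prodM (f : T1 -> R) (g : T2 -> R) : measurable_fun setT f ->
  measurable_fun setT g -> measurable_fun setT (fun p : T1 * T2 => f p.1 * g p.2).
Proof.
move=> mf mg; apply: measurable_funM.
  exact: (measurableT_comp mf measurable_fst).
exact: (measurableT_comp mg measurable_snd).
Qed.

Lemma intble_prodM (f : T1 -> R) (g : T2 -> R) : intble m1 f -> intble m2 g ->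
  intble (m1 \x m2)%E (fun p => f p.1 * g p.2).
Proof.
move=> fi gi.
have mf := intble_measurable fi; have mg := intble_measurable gi.
apply/integrable12ltyP; first by apply/measurable_EFinP; exact: (measurable_prodM mf mg).
rewrite /=; under eq_integral => x _.
  under eq_integral => y _ do rewrite normrM EFinM.
  rewrite ge0_integralZl//=; last first.
    by apply/measurable_EFinP; exact: measurableT_comp.
  over.
have /integrableP[_ gy] := gi; have /integrableP[_ fy] := fi.
rewrite ge0_integralZr//=; last 2 first.
- by apply/measurable_EFinP; exact: measurableT_comp.
- exact: integral_ge0.
by apply: lte_mul_pinfty => //; [exact: integral_ge0|rewrite ge0_fin_numE//; exact: integral_ge0].
Qed.

(** The pointwise integrability of the sections makes the inner real-valued
    integrals equal to the extended ones everywhere, not only almost everywhere. *)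
Lemma Rfubini (f : T1 * T2 -> R) : intble (m1 \x m2)%E f ->
  (forall x, intble m2 (fun y => f (x, y))) ->
  \int[m1]_x \int[m2]_y f (x, y) = \int[(m1 \x m2)%E]_p f p.
Proof.
move=> fi f1; rewrite {3}/Rintegral -integral12_prod_meas1//.
rewrite {1}/Rintegral; congr fine; apply: eq_integral => x _.
by rewrite EFin_Rintegral.
Qed.

Lemma Rfubini_swap (f : T1 * T2 -> R) : intble (m1 \x m2)%E f ->
  (forall x, intble m2 (fun y => f (x, y))) ->
  (forall y, intble m1 (fun x => f (x, y))) ->
  \int[m1]_x \int[m2]_y f (x, y) = \int[m2]_y \int[m1]_x f (x, y).
Proof.
move=> fi f1 f2; rewrite Rfubini// /Rintegral -integral21_prod_meas1//.
congr fine; apply: eq_integral => y _.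
by rewrite /fubini_G /= -(EFin_Rintegral (f2 y)).
Qed.

Lemma Rintegral_prodM (f : T1 -> R) (g : T2 -> R) : intble m1 f -> intble m2 g ->
  \int[(m1 \x m2)%E]_p (f p.1 * g p.2) = (\int[m1]_x f x) * (\int[m2]_x g x).
Proof.
move=> fi gi; rewrite -Rfubini/=; last 2 first.
- exact: intble_prodM.
- by move=> x; exact: intbleZ.
rewrite -RintegralZr//; apply: eq_Rintegral => x _.
by rewrite RintegralZl.
Qed.

End product_integrals.

(** * Integrals of tensor products over the space R^n *)
Section lebesgue_tensor.
Context {R : realType}.
Notation leb := (@lebesgue_measure R).
Notation lebV := (@lebesgue_rV R).

(** Lebesgue measure on R^(n+1) is the image of a product by [row_cons]; this and
    the next lemma turn integrals over R^(n+1) into integrals over R x R^n. *)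
Lemma intble_rV_succ n (f : 'rV[R]_n.+1 -> R) : measurable_fun setT f ->
  intble (leb \x lebV n)%E (f \o @row_cons R n) -> intble (lebV n.+1) f.
Proof.
move=> mf fi.
by apply: (integrable_pushforward (@measurable_row_cons R n)) => //; exact/measurable_EFinP.
Qed.

Lemma Rintegral_rV_succ n (f : 'rV[R]_n.+1 -> R) : measurable_fun setT f ->
  intble (leb \x lebV n)%E (f \o @row_cons R n) ->
  \int[lebV n.+1]_x f x = \int[(leb \x lebV n)%E]_p f (row_cons p).
Proof.
move=> mf fi; congr fine.
by apply: (integral_pushforward (@measurable_row_cons R n)) => //; exact/measurable_EFinP.
Qed.

Lemma row_cons0 n (p : measurableTypeR R * 'rV[R]_n) : row_cons p 0 ord0 = p.1.
Proof.
rewrite /row_cons mxE; case: fintype.splitP => [i _|k] //=.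
by rewrite ord1 mxE eqxx mulr1n.
Qed.

Lemma row_consS n (p : measurableTypeR R * 'rV[R]_n) i :
  row_cons p 0 (lift ord0 i) = p.2 0 i.
Proof.
rewrite /row_cons mxE; case: fintype.splitP => [j|k]/=; first by rewrite (ord1 j).
by rewrite /bump/= !add1n => -[/ord_inj->].
Qed.

Lemma measurable_coord n (i : 'I_n) : measurable_fun setT (fun x : 'rV[R]_n => x 0 i).
Proof. exact: measurable_mx_coord. Qed.

Lemma measurable_tensor n (F : 'I_n -> R -> R) :
  (forall i, measurable_fun setT (F i)) ->
  measurable_fun setT (fun x : 'rV[R]_n => \prod_i F i (x 0 i)).
Proof.
move=> mF; apply: measurable_prod => i _.
exact: (measurableT_comp (mF i) (measurable_coord i)).
Qed.

Lemma rV0_eq0 (x : 'rV[R]_0) : x = 0.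
Proof. by apply/rowP => -[]. Qed.

Lemma Rintegral_rV0 (f : 'rV[R]_0 -> R) : intble (lebV 0) f /\ \int[lebV 0]_x f x = f 0.
Proof.
have mf : measurable_fun setT f.
  by rewrite (_ : f = cst (f 0)); [exact: measurable_cst|apply/funext => x; rewrite (rV0_eq0 x)].
have mf' : measurable_fun setT (EFin \o f) by exact/measurable_EFinP.
have mg : measurable_fun setT (fun x => `|(f x)%:E|%E) by exact: measurableT_comp.
split.
  apply/integrableP; split => //=.
  by rewrite (integral_dirac (0 : 'rV[R]_0) measurableT mg) diracT mul1e ltry.
by rewrite /Rintegral/= (integral_dirac (0 : 'rV[R]_0) measurableT mf') diracT mul1e.
Qed.

Lemma intble_tensor n (F : 'I_n -> R -> R) : (forall i, intble leb (F i)) ->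
  intble (lebV n) (fun x => \prod_i F i (x 0 i)) /\
  \int[lebV n]_x (\prod_i F i (x 0 i)) = \prod_i \int[leb]_x F i x.
Proof.
elim: n F => [|n IH] F iF.
  by have [? ->] := Rintegral_rV0 (fun x => \prod_i F i (x 0 i)); rewrite !big_ord0.
have [i2 e2] := IH _ (fun i => iF (lift ord0 i)).
have mF : measurable_fun setT (fun x : 'rV[R]_n.+1 => \prod_i F i (x 0 i)).
  by apply: measurable_tensor => i; exact: intble_measurable (iF i).
have E : (fun x : 'rV[R]_n.+1 => \prod_i F i (x 0 i)) \o @row_cons R n =
    (fun p => F ord0 p.1 * \prod_(i < n) F (lift ord0 i) (p.2 0 i)).
  apply/funext => p; rewrite /= big_ord_recl row_cons0.
  by congr (_ * _); apply: eq_bigr => i _; rewrite row_consS.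
have i3 : intble (leb \x lebV n)%E ((fun x : 'rV[R]_n.+1 => \prod_i F i (x 0 i)) \o @row_cons R n).
  rewrite E; exact: (intble_prodM (iF ord0) i2).
split; first exact: intble_rV_succ.
rewrite Rintegral_rV_succ//.
rewrite big_ord_recl -e2 -(Rintegral_prodM (iF ord0) i2).
by apply: eq_Rintegral => p _; exact: (congr1 (fun h => h p) E).
Qed.

Lemma measurable_lin n (b : 'I_n -> R) :
  measurable_fun setT (fun x : 'rV[R]_n => \sum_i b i * x 0 i).
Proof.
apply: measurable_sum => i; apply: measurable_funM => //.
exact: measurable_coord.
Qed.

Lemma measurable_cosR : measurable_fun setT (@cos R).
Proof. by apply: continuous_measurable_fun; exact: continuous_cos. Qed.

Lemma measurable_sinR : measurable_fun setT (@sin R).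
Proof. by apply: continuous_measurable_fun; exact: continuous_sin. Qed.

Lemma intble_bdM d (T : measurableType d) (mu : {measure set T -> \bar R}) (h f : T -> R) :
  measurable_fun setT h -> (forall x, `|h x| <= 1) -> intble mu f ->
  intble mu (fun x => h x * f x).
Proof.
move=> mh h1 fi; apply: (@intble_le _ _ _ mu _ (fun x => `|f x|)).
- by apply: measurable_funM => //; exact: intble_measurable fi.
- by move=> x; rewrite normrM ler_piMl.
- exact: integrable_norm.
Qed.

Lemma intble_Mbd d (T : measurableType d) (mu : {measure set T -> \bar R}) (h f : T -> R) :
  measurable_fun setT h -> (forall x, `|h x| <= 1) -> intble mu f ->
  intble mu (fun x => f x * h x).
Proof.
move=> mh h1 fi; have := intble_bdM mh h1 fi.
by apply: eq_intble => x; rewrite mulrC.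
Qed.

(** The Fourier transform of a tensor product of even functions is the tensor
    product of the transforms; evenness enters through the vanishing of the sine
    transforms.  The induction on n uses the addition formulas, whence the joint
    statement on cosine and sine. *)
Lemma tensor_trig n (F : 'I_n -> R -> R) (b : 'I_n -> R) :
  (forall i, intble leb (F i)) ->
  (forall i, \int[leb]_x (F i x * sin (b i * x)) = 0) ->
  \int[lebV n]_x (cos (\sum_i b i * x 0 i) * \prod_i F i (x 0 i)) =
    \prod_i \int[leb]_x (F i x * cos (b i * x)) /\
  \int[lebV n]_x (sin (\sum_i b i * x 0 i) * \prod_i F i (x 0 i)) = 0.
Proof.
elim: n F b => [|n IH] F b iF sF.
  have [_ ->] := Rintegral_rV0 (fun x => cos (\sum_i b i * x 0 i) * \prod_i F i (x 0 i)).
  have [_ ->] := Rintegral_rV0 (fun x => sin (\sum_i b i * x 0 i) * \prod_i F i (x 0 i)).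
  by rewrite !big_ord0 cos0 sin0 mul0r mulr1.
have [IHc IHs] := IH _ _ (fun i => iF (lift ord0 i)) (fun i => sF (lift ord0 i)).
have [i2 _] := intble_tensor (fun i => iF (lift ord0 i)).
have [iT _] := intble_tensor iF.
have mL := measurable_lin b.
have mL' := measurable_lin (fun i => b (lift ord0 i)).
have ic0 : intble leb (fun x => F ord0 x * cos (b ord0 * x)).
  apply: intble_Mbd => //; first exact: measurable_cosM.
  by move=> x; exact: ler_norm_cos.
have is0 : intble leb (fun x => F ord0 x * sin (b ord0 * x)).
  apply: intble_Mbd => //; first exact: measurable_sinM.
  by move=> x; exact: ler_norm_sin.
pose L (x : 'rV[R]_n) := \sum_(i < n) b (lift ord0 i) * x 0 i.
pose P (x : 'rV[R]_n) := \prod_(i < n) F (lift ord0 i) (x 0 i).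
have ic' : intble (lebV n) (fun x => cos (L x) * P x).
  apply: intble_bdM => //; first exact: (measurableT_comp measurable_cosR mL').
  by move=> x; exact: ler_norm_cos.
have is' : intble (lebV n) (fun x => sin (L x) * P x).
  apply: intble_bdM => //; first exact: (measurableT_comp measurable_sinR mL').
  by move=> x; exact: ler_norm_sin.
have eL (p : measurableTypeR R * 'rV[R]_n) :
    \sum_(i < n) b (lift ord0 i) * (row_cons p) 0 (lift ord0 i) = L p.2.
  by apply: eq_bigr => i _; rewrite row_consS.
have eP (p : measurableTypeR R * 'rV[R]_n) :
    \prod_(i < n) F (lift ord0 i) ((row_cons p) 0 (lift ord0 i)) = P p.2.
  by apply: eq_bigr => i _; rewrite row_consS.
have Ec (p : measurableTypeR R * 'rV[R]_n) :
    cos (\sum_i b i * (row_cons p) 0 i) * \prod_i F i ((row_cons p) 0 i) =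
    (F ord0 p.1 * cos (b ord0 * p.1)) * (cos (L p.2) * P p.2) -
    (F ord0 p.1 * sin (b ord0 * p.1)) * (sin (L p.2) * P p.2).
  rewrite !big_ord_recl row_cons0.
  by rewrite (eL p) (eP p) cosD; ring.
have Es (p : measurableTypeR R * 'rV[R]_n) :
    sin (\sum_i b i * (row_cons p) 0 i) * \prod_i F i ((row_cons p) 0 i) =
    (F ord0 p.1 * sin (b ord0 * p.1)) * (cos (L p.2) * P p.2) +
    (F ord0 p.1 * cos (b ord0 * p.1)) * (sin (L p.2) * P p.2).
  rewrite !big_ord_recl row_cons0.
  by rewrite (eL p) (eP p) sinD; ring.
have mT := intble_measurable iT.
split.
  rewrite Rintegral_rV_succ; last 2 first.
  - by apply: measurable_funM => //; exact: (measurableT_comp measurable_cosR mL).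
  - rewrite (_ : EFin \o _ = EFin \o fun p => (F ord0 p.1 * cos (b ord0 * p.1)) * (cos (L p.2) * P p.2) -
        (F ord0 p.1 * sin (b ord0 * p.1)) * (sin (L p.2) * P p.2)).
      exact: (intbleB (intble_prodM ic0 ic') (intble_prodM is0 is')).
    by apply/funext => p; rewrite /= Ec.
  under eq_Rintegral do rewrite Ec.
  rewrite RintegralB//; [|exact: (intble_prodM ic0 ic')|exact: (intble_prodM is0 is')].
  by rewrite (Rintegral_prodM ic0 ic') (Rintegral_prodM is0 is') IHc IHs mulr0 subr0 big_ord_recl.
rewrite Rintegral_rV_succ; last 2 first.
- by apply: measurable_funM => //; exact: (measurableT_comp measurable_sinR mL).
- rewrite (_ : EFin \o _ = EFin \o fun p => (F ord0 p.1 * sin (b ord0 * p.1)) * (cos (L p.2) * P p.2) +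
      (F ord0 p.1 * cos (b ord0 * p.1)) * (sin (L p.2) * P p.2)).
    exact: (intbleD (intble_prodM is0 ic') (intble_prodM ic0 is')).
  by apply/funext => p; rewrite /= Es.
under eq_Rintegral do rewrite Es.
rewrite RintegralD//; [|exact: (intble_prodM is0 ic')|exact: (intble_prodM ic0 is')].
by rewrite (Rintegral_prodM is0 ic') (Rintegral_prodM ic0 is') IHs sF mul0r mulr0 addr0.
Qed.

End lebesgue_tensor.

(** * Plancherel's inequality *)
Section plancherel.
Context {R : realType}.
Variable n : nat.
Notation leb := (@lebesgue_measure R).
Notation V := 'rV[R]_n.
Notation lebV := (@lebesgue_rV R n).
Implicit Types x y : V.

Lemma dotvC x y : dotv x y = dotv y x.
Proof. by apply: eq_bigr => i _; rewrite mulrC. Qed.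

Lemma dotvBr x y (z : V) : dotv x (y - z) = dotv x y - dotv x z.
Proof.
by rewrite -sumrB; apply: eq_bigr => i _; rewrite !mxE mulrBr.
Qed.

Lemma dotvv_ge0 x : 0 <= dotv x x.
Proof. by apply: sumr_ge0 => i _; rewrite -expr2 sqr_ge0. Qed.

Lemma enorm_sqr x : enorm x ^+ 2 = dotv x x.
Proof. by rewrite sqr_sqrtr// dotvv_ge0. Qed.

Lemma enorm_coord x i : `|x 0 i| <= enorm x.
Proof.
rewrite -[`|x 0 i|]ger0_norm// -sqrtr_sqr real_normK ?num_real// ler_wsqrtr//.
rewrite /dotv (bigD1 i)//= -expr2 lerDl.
by apply: sumr_ge0 => j _; rewrite -expr2 sqr_ge0.
Qed.

Lemma measurable_dotv d (T : measurableType d) (f g : T -> V) :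
  measurable_fun setT f -> measurable_fun setT g ->
  measurable_fun setT (fun t => dotv (f t) (g t)).
Proof.
move=> mf mg; apply: measurable_sum => i; apply: measurable_funM.
  exact: (measurableT_comp (measurable_coord i) mf).
exact: (measurableT_comp (measurable_coord i) mg).
Qed.

(** Given as a product, which is the form that [intble_tensor] and [tensor_trig]
    handle. *)
Definition gauV (a : R) x : R := \prod_i gau a (x 0 i).

Lemma gauVE a x : gauV a x = expR (- (a * dotv x x)).
Proof.
rewrite /gauV /gau -expR_sum; congr expR.
by rewrite sumrN mulr_sumr; congr (- _); apply: eq_bigr => i _; rewrite expr2.
Qed.

Lemma gauV_gt0 a x : 0 < gauV a x. Proof. by rewrite gauVE expR_gt0. Qed.

Lemma gauV_ge0 a x : 0 <= gauV a x. Proof. exact/ltW/gauV_gt0. Qed.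

Lemma measurable_gauV a : measurable_fun setT (gauV a).
Proof. by apply: (@measurable_tensor R n (fun=> gau a)) => i; exact: measurable_gau. Qed.

Lemma intble_gauV a : 0 < a -> intble lebV (gauV a).
Proof.
by move=> a0; have [] := @intble_tensor R n (fun=> gau a) (fun=> intble_gau a0).
Qed.

(** The Fourier transform of e^(- pi e |x|^2): a heat kernel, hence an
    approximate identity as e tends to 0. *)
Definition heat (e : R) x : R := \prod_(i < n) ((Num.sqrt e)^-1 * gau (pi / e) (x 0 i)).

Lemma heat_ge0 e x : 0 <= heat e x.
Proof. by apply: prodr_ge0 => i _; rewrite mulr_ge0 ?gau_ge0// invr_ge0. Qed.

Lemma heatN e x : heat e (- x) = heat e x.
Proof. by apply: eq_bigr => i _; rewrite mxE /gau sqrrN. Qed.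

Lemma measurable_heat e : measurable_fun setT (heat e).
Proof.
apply: (@measurable_tensor R n (fun _ t => (Num.sqrt e)^-1 * gau (pi / e) t)) => i.
by apply: measurable_funM => //; exact: measurable_gau.
Qed.

Lemma fourier_gauV e x : 0 < e ->
  \int[lebV]_y (cos (2 * pi * dotv y x) * gauV (pi * e) y) = heat e x.
Proof.
move=> e0; have pe : 0 < pi * e by rewrite mulr_gt0 ?pi_gt0.
have H b : \int[leb]_t (gau (pi * e) t * sin (b * t)) = 0.
  rewrite -[RHS](gsin1 b pe); apply: eq_Rintegral => t _.
  by rewrite hornerC mul1r.
have := tensor_trig (fun i : 'I_n => intble_gau pe) (fun i => H (2 * pi * x 0 i)).
case=> E _; transitivity (\int[lebV]_y
   (cos (\sum_i 2 * pi * x 0 i * y 0 i) * \prod_i gau (pi * e) (y 0 i))).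
  apply: eq_Rintegral => y _; congr (cos _ * _).
  by rewrite /dotv mulr_sumr; apply: eq_bigr => i _; ring.
rewrite E; apply: eq_bigr => i _.
transitivity (gcos (pi * e) 1 (2 * pi * x 0 i)).
  by apply: eq_Rintegral => t _; rewrite hornerC mul1r.
rewrite gcos1//; congr (_ * _).
  rewrite -sqrtrV ?ltW//; congr Num.sqrt.
  by move: (pi : R) (pi_gt0 R) {pe H E} => P P0; field; rewrite !gt_eqF.
rewrite /gau; congr expR.
by move: (pi : R) (pi_gt0 R) {pe H E} => P P0; field; rewrite !gt_eqF.
Qed.

(** The mass does not depend on the centre x, because this holds on the line. *)
Lemma integral_heat e x : 0 < e ->
  (\int[lebV]_y (heat e (y - x))%:E = 1)%E.
Proof.
move=> e0; have pe : 0 < pi / e by rewrite divr_gt0 ?pi_gt0.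
pose F (i : 'I_n) (t : R) := (Num.sqrt e)^-1 * gau (pi / e) (t - x 0 i).
have iF i : intble leb (F i) by apply: intbleZ; exact: intble_gau_shift.
have [iT eT] := intble_tensor iF.
transitivity ((\int[lebV]_y (\prod_i F i (y 0 i)))%:E); last first.
  rewrite eT big1// => i _.
  rewrite RintegralZl//; last exact: intble_gau_shift.
  rewrite integral_gau_shift// -sqrtrV ?ltW// -sqrtrM ?invr_ge0 ?ltW//.
  rewrite (_ : e^-1 * _ = 1) ?sqrtr1//.
  by move: (pi : R) (pi_gt0 R) {pe F iF iT eT} => P P0; field; rewrite !gt_eqF.
rewrite EFin_Rintegral//; apply: eq_integral => y _; congr EFin.
by apply: eq_bigr => i _; rewrite !mxE.
Qed.

Section inequality.
Variable g : V -> R.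
Hypotheses (ig : intble lebV g) (ig2 : intble lebV (fun x => g x ^+ 2)).

Let mg : measurable_fun setT g := intble_measurable ig.

(** Real and imaginary parts of the inverse Fourier transform of g. *)
Definition cosT x := \int[lebV]_y (cos (2 * pi * dotv x y) * g y).
Definition sinT x := \int[lebV]_y (sin (2 * pi * dotv x y) * g y).

Let mcosdot x : measurable_fun setT (fun y => cos (2 * pi * dotv x y)).
Proof.
apply: (measurableT_comp measurable_cosR); apply: measurable_funM => //.
exact: measurable_dotv.
Qed.

Let msindot x : measurable_fun setT (fun y => sin (2 * pi * dotv x y)).
Proof.
apply: (measurableT_comp measurable_sinR); apply: measurable_funM => //.
exact: measurable_dotv.
Qed.

Lemma intble_cosT x : intble lebV (fun y => cos (2 * pi * dotv x y) * g y).
Proof. by apply: intble_bdM => // y; exact: ler_norm_cos. Qed.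

Lemma intble_sinT x : intble lebV (fun y => sin (2 * pi * dotv x y) * g y).
Proof. by apply: intble_bdM => // y; exact: ler_norm_sin. Qed.

Let sq x := cosT x ^+ 2 + sinT x ^+ 2.

Let sq_ge0 x : 0 <= sq x.
Proof. by rewrite addr_ge0 ?sqr_ge0. Qed.

Let gg (p : V * V) := g p.1 * g p.2.

Let igg : intble (lebV \x lebV)%E gg. Proof. exact: intble_prodM. Qed.

(** Integrated over p = (y, z), K e (x, p) gives |g^v(x)|^2 e^(- pi e |x|^2);
    integrated over x, it gives g(y) g(z) times the heat kernel at y - z.
    Fubini's theorem compares the two. *)
Let K e (q : V * (V * V)) : R :=
  cos (2 * pi * dotv q.1 (q.2.1 - q.2.2)) * (gauV (pi * e) q.1 * gg q.2).

Let mcosK : measurable_fun setT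
  (fun q : V * (V * V) => cos (2 * pi * dotv q.1 (q.2.1 - q.2.2))).
Proof.
apply: (measurableT_comp measurable_cosR); apply: measurable_funM => //.
under eq_fun do rewrite dotvBr.
apply: measurable_funB; apply: measurable_dotv => //.
- exact: measurableT_comp.
- exact: measurableT_comp.
Qed.

Let iK e : 0 < e -> intble (lebV \x sfprod lebV lebV)%E (K e).
Proof.
move=> e0; apply: (@intble_bdM R _ _ (lebV \x sfprod lebV lebV)%E
    (fun q : V * (V * V) => cos (2 * pi * dotv q.1 (q.2.1 - q.2.2)))
    (fun q : V * (V * V) => gauV (pi * e) q.1 * gg q.2)) => //.
  by move=> q; exact: ler_norm_cos.
by apply: intble_prodM => //; apply: intble_gauV; rewrite mulr_gt0 ?pi_gt0.
Qed.

Let iK1 e x : intble (lebV \x lebV)%E (fun p => K e (x, p)).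
Proof.
apply: intble_bdM.
- apply: (measurableT_comp measurable_cosR); apply: measurable_funM => //=.
  under eq_fun do rewrite dotvBr.
  apply: measurable_funB; exact: measurable_dotv.
- by move=> q; exact: ler_norm_cos.
- exact: (@intbleZ _ _ _ (lebV \x lebV)%E gg (gauV (pi * e) x) igg).
Qed.

Let iK2 e p : 0 < e -> intble lebV (fun x => K e (x, p)).
Proof.
move=> e0; apply: intble_bdM.
- apply: (measurableT_comp measurable_cosR); apply: measurable_funM => //=.
  exact: measurable_dotv.
- by move=> q; exact: ler_norm_cos.
- have iW : intble lebV (gauV (pi * e)) by apply: intble_gauV; rewrite mulr_gt0 ?pi_gt0.
  have := @intbleZ _ _ _ lebV _ (gg p) iW.
  by apply: eq_intble => y; rewrite /= mulrC.
Qed.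

Let sqE e x : \int[(lebV \x lebV)%E]_p K e (x, p) = sq x * gauV (pi * e) x.
Proof.
have := iK1 0 x; have ic := intble_cosT x; have is_ := intble_sinT x.
rewrite /sq /cosT /sinT !expr2 -(Rintegral_prodM ic ic) -(Rintegral_prodM is_ is_).
have i1 := intble_prodM ic ic; have i2 := intble_prodM is_ is_.
rewrite -RintegralD// -RintegralZr//; last exact: intbleD.
move=> _; apply: eq_Rintegral => p _.
by rewrite /K /gg /= dotvBr mulrBr cosB; ring.
Qed.

Let isq e : 0 < e -> intble lebV (fun x => sq x * gauV (pi * e) x).
Proof.
move=> e0; have := integrable_fubini_F (iK e0).
congr (integrable _ _ _); apply/funext => x.
by rewrite /= -(sqE e x) /fubini_F EFin_Rintegral.
Qed.

(** Fubini's theorem makes the product with a Gaussian measurable, and the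
    Gaussian does not vanish. *)
Lemma measurable_cosT2_sinT2 : measurable_fun setT sq.
Proof.
have -> : sq = fun x => sq x * gauV (pi * 1) x * (gauV (pi * 1) x)^-1.
  by apply/funext => x; rewrite mulfK// gt_eqF// gauV_gt0.
apply: measurable_funM; first exact: intble_measurable (isq ltr01).
under eq_fun do rewrite gauVE -expRN.
apply: (measurableT_comp (@measurable_expR R)); apply: measurableT_comp => //.
by apply: measurableT_comp => //; apply: measurable_funM => //; exact: measurable_dotv.
Qed.

Let mheatD e : measurable_fun setT (fun p : V * V => heat e (p.1 - p.2)).
Proof.
apply: (measurableT_comp (measurable_heat e)); apply: measurable_fun_mx => i j.
under eq_fun do rewrite !mxE; rewrite (ord1 i).
apply: measurable_funB.
  exact: (measurableT_comp (measurable_coord j) measurable_fst).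
exact: (measurableT_comp (measurable_coord j) measurable_snd).
Qed.

(** Young's inequality: bound |g(y) g(z)| by (g(y)^2 + g(z)^2) / 2 and integrate
    the kernel, of mass 1, in the other variable. *)
Let young e : 0 < e ->
  (\int[lebV \x lebV]_p (`|gg p| * heat e (p.1 - p.2))%:E <=
   \int[lebV]_x (g x ^+ 2)%:E)%E.
Proof.
move=> e0.
pose h1 (p : V * V) := (2^-1 * g p.1 ^+ 2 * heat e (p.1 - p.2)).
pose h2 (p : V * V) := (2^-1 * g p.2 ^+ 2 * heat e (p.1 - p.2)).
have h10 p : 0 <= h1 p by rewrite mulr_ge0 ?heat_ge0// mulr_ge0 ?sqr_ge0.
have h20 p : 0 <= h2 p by rewrite mulr_ge0 ?heat_ge0// mulr_ge0 ?sqr_ge0.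
have m1 : measurable_fun setT h1.
  apply: measurable_funM => //; apply: measurable_funM => //.
  by apply: measurable_funX; exact: (measurableT_comp mg measurable_fst).
have m2 : measurable_fun setT h2.
  apply: measurable_funM => //; apply: measurable_funM => //.
  by apply: measurable_funX; exact: (measurableT_comp mg measurable_snd).
have mh p : measurable_fun setT (fun y : V => heat e (y - p)).
  apply: (measurableT_comp (measurable_heat e)); apply: measurable_fun_mx => i j.
  under eq_fun do rewrite !mxE; rewrite (ord1 i).
  by apply: measurable_funB => //; exact: measurable_coord.
have mg2 : measurable_fun setT (fun x => (2^-1 * g x ^+ 2)).
  by apply: measurable_funM => //; exact: measurable_funX.
have E1 : (\int[lebV \x lebV]_p (h1 p)%:E = \int[lebV]_x (2^-1 * g x ^+ 2)%:E)%E.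
  rewrite fubini_tonelli1; [|exact/measurable_EFinP|by move=> p; rewrite lee_fin].
  apply: eq_integral => x _; rewrite /fubini_F /h1/=.
  under eq_integral do rewrite EFinM -opprB heatN.
  rewrite ge0_integralZl ?integral_heat ?mule1//.
  - by apply/measurable_EFinP; exact: (mh x).
  - by move=> y _; rewrite lee_fin heat_ge0.
  - by rewrite lee_fin mulr_ge0// sqr_ge0.
have E2 : (\int[lebV \x lebV]_p (h2 p)%:E = \int[lebV]_x (2^-1 * g x ^+ 2)%:E)%E.
  rewrite fubini_tonelli2; [|exact/measurable_EFinP|by move=> p; rewrite lee_fin].
  apply: eq_integral => x _; rewrite /fubini_G /h2/=.
  under eq_integral do rewrite EFinM.
  rewrite ge0_integralZl ?integral_heat ?mule1//.
  - by apply/measurable_EFinP; exact: (mh x).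
  - by move=> y _; rewrite lee_fin heat_ge0.
  - by rewrite lee_fin mulr_ge0// sqr_ge0.
apply: (@le_trans _ _ (\int[lebV \x lebV]_p ((h1 p)%:E + (h2 p)%:E))%E).
  apply: ge0_le_integral => //.
  - by move=> p _; rewrite lee_fin mulr_ge0 ?heat_ge0.
  - apply/measurable_EFinP; apply: measurable_funM => //.
    by apply: measurableT_comp => //; exact: intble_measurable igg.
  - by apply: emeasurable_funD; exact/measurable_EFinP.
  - move=> p _; rewrite lee_fin -mulrDl ler_wpM2r ?heat_ge0// /gg normrM.
    have := sqr_ge0 (`|g p.1| - `|g p.2|).
    rewrite -[g p.1 ^+ 2]real_normK ?num_real// -[g p.2 ^+ 2]real_normK ?num_real//.
    by move: `|_| `|_| => u v; nra.
rewrite ge0_integralD//; [|by move=> p _; rewrite lee_fin|exact/measurable_EFinP|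
  by move=> p _; rewrite lee_fin|exact/measurable_EFinP].
rewrite E1 E2 -ge0_integralD//; [|
  by move=> p _; rewrite lee_fin mulr_ge0// sqr_ge0|exact/measurable_EFinP|
  by move=> p _; rewrite lee_fin mulr_ge0// sqr_ge0|exact/measurable_EFinP].
rewrite le_eqVlt; apply/orP; left; apply/eqP; apply: eq_integral => x _.
by rewrite -EFinD; congr EFin; field.
Qed.

Let regularized e : 0 < e ->
  (\int[lebV]_x (sq x * gauV (pi * e) x)%:E <= \int[lebV]_x (g x ^+ 2)%:E)%E.
Proof.
move=> e0; rewrite -EFin_Rintegral; last exact: isq.
under eq_Rintegral do rewrite -sqE.
rewrite (Rfubini_swap (iK e0))//; last by move=> p; exact: iK2.
under eq_Rintegral => p _.
  rewrite /K /= (_ : \int[_]_x _ = gg p * heat e (p.1 - p.2)); last first.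
    rewrite -fourier_gauV// -RintegralZl//; last first.
      apply: intble_bdM.
      - apply: (measurableT_comp measurable_cosR); apply: measurable_funM => //=.
        exact: measurable_dotv.
      - by move=> q; exact: ler_norm_cos.
      - by apply: intble_gauV; rewrite mulr_gt0 ?pi_gt0.
    by apply: eq_Rintegral => x _; ring.
  over.
have mgh : measurable_fun setT (fun p : V * V => gg p * heat e (p.1 - p.2)).
  by apply: measurable_funM => //; exact: intble_measurable igg.
have igh : intble (lebV \x lebV)%E (fun p : V * V => gg p * heat e (p.1 - p.2)).
  apply/integrableP; split; first exact/measurable_EFinP.
  apply: (@le_lt_trans _ _ (\int[lebV]_x (g x ^+ 2)%:E)%E).
    rewrite (le_trans _ (young e0))// ge0_le_integral//=.
    - by apply/measurable_EFinP; exact: (measurableT_comp _ mgh).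
    - apply/measurable_EFinP; apply: measurable_funM => //.
      by apply: measurableT_comp => //; exact: intble_measurable igg.
    - by move=> p _; rewrite lee_fin normrM (ger0_norm (heat_ge0 _ _)).
  by rewrite -EFin_Rintegral// ltry.
rewrite EFin_Rintegral// (le_trans _ (young e0))//.
apply: le_integral => //.
  have := integrable_norm igh; congr (integrable _ _ _).
  by apply/funext => p; rewrite /= normrM (ger0_norm (heat_ge0 _ _)).
by move=> p _; rewrite lee_fin ler_wpM2r ?heat_ge0// ler_norm.
Qed.

(** The regularization e^(- pi e |x|^2) increases to 1 as e = 1/(k+1) decreases
    to 0, so that the bound [regularized] passes to the limit by monotone
    convergence. *)
Lemma plancherel_le : (\int[lebV]_x (cosT x ^+ 2 + sinT x ^+ 2)%:E <=
  \int[lebV]_x (g x ^+ 2)%:E)%E.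
Proof.
pose f k x := (sq x * gauV (pi * harmonic k) x)%:E.
have h0 k : 0 < harmonic k :> R by rewrite /harmonic/= invr_gt0.
have mf k : measurable_fun setT (f k).
  apply/measurable_EFinP; apply: measurable_funM; first exact: measurable_cosT2_sinT2.
  exact: measurable_gauV.
have f0 k x : setT x -> (0 <= f k x)%E.
  by move=> _; rewrite lee_fin mulr_ge0 ?gauV_ge0.
have fnd x : setT x -> {homo f ^~ x : k m / (k <= m)%N >-> (k <= m)%E}.
  move=> _ k m km; rewrite lee_fin ler_wpM2l// !gauVE ler_expR lerN2.
  rewrite ler_wpM2r ?dotvv_ge0// ler_wpM2l ?pi_ge0// /harmonic/=.
  by rewrite lef_pV2 ?posrE// ler_nat.
have cvW x : gauV (pi * harmonic k) x @[k --> \oo] --> (1 : R).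
  rewrite (_ : (fun k => _) = (fun k => expR (- (pi * harmonic k * dotv x x)))); last first.
    by apply/funext => k; rewrite gauVE.
  rewrite -[X in _ --> X]expR0; apply: continuous_cvg; first exact: continuous_expR.
  rewrite -[X in _ --> X]oppr0; apply: cvgN; rewrite -[X in _ --> X](mul0r (dotv x x)).
  apply: cvgM; last exact: cvg_cst.
  rewrite -[X in _ --> X](mulr0 pi); apply: cvgM; first exact: cvg_cst.
  exact: cvg_harmonic.
have cvf x : f k x @[k --> \oo] --> (sq x)%:E.
  apply: cvg_EFin; first exact: nearW.
  rewrite -[X in _ --> X]mulr1; apply: cvgM; first exact: cvg_cst.
  exact: cvW.
have H := @cvg_monotone_convergence _ _ _ lebV _ measurableT f mf f0 fnd.
have -> : (\int[lebV]_x (cosT x ^+ 2 + sinT x ^+ 2)%:E =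
    \int[lebV]_x limn (f ^~ x))%E.
  by apply: eq_integral => x _; rewrite (cvg_lim _ (cvf x)).
rewrite -(cvg_lim _ H)//; apply: lime_le.
  by apply/cvg_ex; eexists; exact: H.
by apply: nearW => k; exact: regularized.
Qed.

End inequality.

End plancherel.

(** * Moments of radial Gaussian densities *)
Section radial_moments.
Context {R : realType}.
Variable n : nat.
Notation leb := (@lebesgue_measure R).
Notation V := 'rV[R]_n.
Notation lebV := (@lebesgue_rV R n).
Implicit Types (x y : V) (m : 'I_n -> nat).

(** Multiplication of the monomial by the square of the i-th coordinate. *)
Definition raise m i : 'I_n -> nat := fun j => (m j + (j == i))%N.

Definition monogau a m x := \prod_i (x 0 i ^+ (2 * m i) * gau a (x 0 i)).

Lemma monogau_raise a m i x : monogau a (raise m i) x = x 0 i ^+ 2 * monogau a m x.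
Proof.
rewrite /monogau (bigD1 i)//= [in RHS](bigD1 i)//= /raise eqxx addn1 mulnS exprD -!mulrA.
congr (_ * (_ * (_ * (_ * _)))); apply: eq_bigr => j /negbTE ->.
by rewrite addn0.
Qed.

(** Expanding one factor |x|^2 reduces statements about |x|^(2k) times a monomial
    to the case k = 0, by induction on k with the monomial generalized. *)
Lemma dotv_monogau a m k x : dotv x x ^+ k.+1 * monogau a m x =
  \sum_i dotv x x ^+ k * monogau a (raise m i) x.
Proof.
rewrite exprSr -mulrA [dotv x x * _]mulr_suml mulr_sumr.
by apply: eq_bigr => i _; rewrite monogau_raise expr2.
Qed.

Lemma monogau0 a x : monogau a (fun=> 0%N) x = gauV a x.
Proof. by apply: eq_bigr => i _; rewrite muln0 expr0 mul1r. Qed.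

Lemma intble_monogau a m : 0 < a -> intble lebV (monogau a m).
Proof.
move=> a0.
by have [] := @intble_tensor R n (fun i t => t ^+ (2 * m i) * gau a t)
  (fun i => intble_gmoment (m i) a0).
Qed.

Lemma intble_dotv_monogau a m k : 0 < a ->
  intble lebV (fun x => dotv x x ^+ k * monogau a m x).
Proof.
move=> a0; elim: k m => [|k IH] m.
  by apply: eq_intble (intble_monogau m a0) => x; rewrite mul1r.
have := @intble_sum _ _ _ lebV _ (index_enum 'I_n)
  (fun i x => dotv x x ^+ k * monogau a (raise m i) x) (fun i => IH (raise m i)).
by apply: eq_intble => x; rewrite dotv_monogau.
Qed.

Definition vmoment a m k := \int[lebV]_x (dotv x x ^+ k * monogau a m x).

Lemma vmomentS_raise a m k : 0 < a -> vmoment a m k.+1 = \sum_i vmoment a (raise m i) k.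
Proof.
move=> a0; rewrite -Rintegral_sum; last by move=> i; exact: intble_dotv_monogau.
by apply: eq_Rintegral => x _; rewrite dotv_monogau.
Qed.

Lemma vmoment0 a m : 0 < a -> vmoment a m 0 = \prod_i gmoment a (m i).
Proof.
move=> a0.
have [_ <-] := @intble_tensor R n (fun i t => t ^+ (2 * m i) * gau a t)
  (fun i => intble_gmoment (m i) a0).
by apply: eq_Rintegral => x _; rewrite mul1r.
Qed.

Lemma vmoment0_raise a m i : 0 < a ->
  vmoment a (raise m i) 0 = (2 * m i).+1%:R / (2 * a) * vmoment a m 0.
Proof.
move=> a0; rewrite !vmoment0// (bigD1 i)//= [in RHS](bigD1 i)//= mulrA.
rewrite -gmomentS// /raise eqxx addn1; congr (_ * _).
by apply: eq_bigr => j /negbTE ->; rewrite addn0.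
Qed.

(** For k = 0 this adds the one-dimensional recursions up; the induction step
    expands |x|^2, and the factor depends on m through the total degree only. *)
Lemma vmomentS a m k : 0 < a -> vmoment a m k.+1 =
  ((k + \sum_i m i)%:R + n%:R / 2) / a * vmoment a m k.
Proof.
move=> a0; elim: k m => [|k IH] m.
  transitivity (\sum_i (2 * m i).+1%:R / (2 * a) * vmoment a m 0).
    by rewrite vmomentS_raise//; apply: eq_bigr => i _; rewrite vmoment0_raise.
  rewrite -mulr_suml; congr (_ * _); rewrite add0n.
  rewrite -mulr_suml invfM mulrA; congr (_ * _).
  transitivity ((\sum_i (2 * (m i)%:R + 1)) / 2 : R).
    by congr (_ / _); apply: eq_bigr => i _; rewrite -natr1 natrM.
  rewrite big_split/= sumr_const card_ord -mulr_sumr natr_sum; by field.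
rewrite vmomentS_raise// [in RHS]vmomentS_raise// mulr_sumr.
apply: eq_bigr => i _; rewrite IH; congr (((_ + _) / _) * _).
have S1 : (\sum_(j < n) (j == i) = 1)%N.
  by rewrite (bigD1 i)//= eqxx big1 ?addn0// => j /negbTE ->.
by rewrite /raise big_split/= S1 addn1 addnS addSn.
Qed.

(** Up to normalization, a |x|^2 follows under [radgau a k] the Gamma law of
    shape k + n/2. *)
Definition radgau a k x := dotv x x ^+ k * gauV a x.
Definition rmoment a k := \int[lebV]_x radgau a k x.

Lemma radgau_ge0 a k x : 0 <= radgau a k x.
Proof. by rewrite mulr_ge0 ?exprn_ge0 ?dotvv_ge0// gauV_ge0. Qed.

Lemma dotv_radgau a k j x : dotv x x ^+ j * radgau a k x = radgau a (k + j) x.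
Proof. by rewrite /radgau mulrA -exprD addnC. Qed.

Lemma intble_radgau a k : 0 < a -> intble lebV (radgau a k).
Proof.
move=> a0; apply: eq_intble (intble_dotv_monogau (fun=> 0%N) k a0) => x.
by rewrite monogau0.
Qed.

Lemma rmomentE a k : rmoment a k = vmoment a (fun=> 0%N) k.
Proof. by apply: eq_Rintegral => x _; rewrite monogau0. Qed.

Definition gshape (k : nat) : R := k%:R + n%:R / 2.

Lemma gshape_gt0 k : (0 < n)%N -> 0 < gshape k.
Proof. by move=> n0; rewrite ltr_wpDl// divr_gt0// ltr0n. Qed.

Lemma rmomentS a k : 0 < a -> rmoment a k.+1 = gshape k / a * rmoment a k.
Proof. by move=> a0; rewrite !rmomentE vmomentS// big1 ?addn0. Qed.

Lemma rmoment_gt0 a k : 0 < a -> (0 < n)%N -> 0 < rmoment a k.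
Proof.
move=> a0 n0; elim: k => [|k IH].
  by rewrite rmomentE vmoment0//; apply: prodr_gt0 => i _; exact: gmoment_gt0.
by rewrite rmomentS// mulr_gt0// divr_gt0// gshape_gt0.
Qed.

End radial_moments.

(** * Schwartz functions with a radial Gaussian Fourier transform *)
Section polynomial_gaussians.
Context {R : realType}.
Variable n : nat.
Notation V := 'rV[R]_n.
Notation lebV := (@lebesgue_rV R n).
Implicit Types (x y v : V) (f g q : V -> R).

(** Polynomial functions of the coordinates.  The inductive presentation makes
    the closure under derivation and the growth bounds immediate inductions. *)
Inductive polyfun : (V -> R) -> Prop :=
| polyfun_cst c : polyfun (fun=> c)
| polyfun_coord i : polyfun (fun x => x 0 i)
| polyfunD f g : polyfun f -> polyfun g -> polyfun (fun x => f x + g x)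
| polyfunM f g : polyfun f -> polyfun g -> polyfun (fun x => f x * g x).

Lemma polyfun_sum (I : Type) (r : seq I) (F : I -> V -> R) :
  (forall i, polyfun (F i)) -> polyfun (fun x => \sum_(i <- r) F i x).
Proof.
move=> pF; elim: r => [|i r IH].
  by under eq_fun do rewrite big_nil; exact: polyfun_cst.
by under eq_fun do rewrite big_cons; exact: polyfunD.
Qed.

Lemma polyfun_prod (I : Type) (r : seq I) (F : I -> V -> R) :
  (forall i, polyfun (F i)) -> polyfun (fun x => \prod_(i <- r) F i x).
Proof.
move=> pF; elim: r => [|i r IH].
  by under eq_fun do rewrite big_nil; exact: polyfun_cst.
by under eq_fun do rewrite big_cons; exact: polyfunM.
Qed.

Lemma polyfunX f k : polyfun f -> polyfun (fun x => f x ^+ k).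
Proof.
move=> pf; elim: k => [|k IH]; first exact: polyfun_cst.
by under eq_fun do rewrite exprS; exact: polyfunM.
Qed.

Lemma polyfun_horner (p : {poly R}) i : polyfun (fun x => p.[x 0 i]).
Proof.
elim/poly_ind: p => [|p c IH].
  by under eq_fun do rewrite horner0; exact: polyfun_cst.
under eq_fun do rewrite hornerMXaddC.
by apply: polyfunD; [apply: polyfunM => //; exact: polyfun_coord|exact: polyfun_cst].
Qed.

Lemma polyfun_dotvv : polyfun (fun x => dotv x x).
Proof. by apply: polyfun_sum => i; apply: polyfunM; exact: polyfun_coord. Qed.

Lemma polyfun_differentiable f x : polyfun f -> differentiable f x.
Proof.
elim=> [c|i|{}f g _ df _ dg|{}f g _ df _ dg].
- exact: differentiable_cst.
- exact: differentiable_coord.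
- exact: differentiableD.
- exact: differentiableM.
Qed.

Lemma polyfun_measurable f : polyfun f -> measurable_fun setT f.
Proof.
elim=> [c|i|{}f g _ df _ dg|{}f g _ df _ dg].
- exact: measurable_cst.
- exact: measurable_coord.
- exact: measurable_funD.
- exact: measurable_funM.
Qed.

Lemma is_derive_coord x v i : is_derive x v (fun y : V => y 0 i) (v 0 i).
Proof.
apply: DeriveDef; first exact/diff_derivable/differentiable_coord.
rewrite deriveE; last exact: differentiable_coord.
have @f : {linear V -> R}.
  by exists (fun N : V => N 0 i); do 2![eexists]; do ?[constructor];
     rewrite ?mxE// => ? *; rewrite ?mxE//; move=> ?; rewrite !mxE.
by rewrite (_ : (fun y : V => y 0 i) = f)// diff_lin//; exact: coord_continuous.
Qed.

Lemma polyfun_derive f v : polyfun f ->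
  exists2 f', polyfun f' & forall x, is_derive x v f (f' x).
Proof.
elim=> [c|i|{}f g pf [f' pf' df] pg [g' pg' dg]|{}f g pf [f' pf' df] pg [g' pg' dg]].
- by exists (fun=> 0); [exact: polyfun_cst|move=> x; exact: is_derive_cst].
- by exists (fun=> v 0 i); [exact: polyfun_cst|move=> x; exact: is_derive_coord].
- exists (fun x => f' x + g' x); first exact: polyfunD.
  by move=> x; exact: is_deriveD.
- exists (fun x => f x * g' x + g x * f' x).
    by apply: polyfunD; exact: polyfunM.
  by move=> x; exact: is_deriveM.
Qed.

Lemma is_derive_expR_comp q x v (d : R) : differentiable q x ->
  is_derive x v q d -> is_derive x v (fun y => expR (q y)) (expR (q x) * d).
Proof.
move=> dq [_ <-].
have de : differentiable (@expR R) (q x) by exact/derivable1_diffP/derivable_expR.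
have dc : differentiable (expR \o q) x by exact: differentiable_comp.
apply: (@DeriveDef _ _ _ _ _ (expR \o q)); first exact: diff_derivable.
rewrite deriveE// diff_comp//= deriv1E; last exact: derivable_expR.
by rewrite -deriveE// derive1E derive_val /GRing.scale/= mulrC.
Qed.

Definition polygau f := exists2 q, polyfun q & f = fun x => q x * gauV pi x.

Lemma gauV_differentiable a x : differentiable (gauV a : V -> R) x.
Proof.
rewrite (_ : gauV a = fun y => expR (- (a * dotv y y))); last first.
  by apply/funext => y; rewrite gauVE.
apply: (@differentiable_comp _ _ _ _ (fun y : V => - (a * dotv y y)) expR).
  apply: polyfun_differentiable; rewrite (_ : (fun y => _) = (fun y => - a * dotv y y)).
    by apply: polyfunM; [exact: polyfun_cst|exact: polyfun_dotvv].
  by apply/funext => y; rewrite mulNr.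
exact/derivable1_diffP/derivable_expR.
Qed.

Lemma polygau_differentiable f x : polygau f -> differentiable f x.
Proof.
move=> [q pq ->]; apply: differentiableM; first exact: polyfun_differentiable.
exact: gauV_differentiable.
Qed.

(** Since |x|^2 is itself a polynomial function, so is the logarithmic derivative
    of the Gaussian. *)
Lemma polygau_derive f v : polygau f -> polygau ('D_v f).
Proof.
move=> [q pq ->]; have [q' pq' dq] := polyfun_derive v pq.
pose l (y : V) := - pi * dotv y y.
have pl : polyfun l by apply: polyfunM; [exact: polyfun_cst|exact: polyfun_dotvv].
have [l' pl' dl] := polyfun_derive v pl.
exists (fun x => q x * l' x + q' x).
  by apply: polyfunD => //; exact: polyfunM.
apply/funext => x.
have gE : gauV pi = fun y : V => expR (l y).
  by apply/funext => y; rewrite gauVE /l mulNr.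
have dg : is_derive x v (gauV pi : V -> R) (expR (l x) * l' x).
  rewrite gE; apply: is_derive_expR_comp => //.
  exact: polyfun_differentiable.
have [_ ->] := is_deriveM (dq x) dg.
by rewrite gE /GRing.scale/=; ring.
Qed.

Lemma polyfun_le_expR q b : polyfun q -> 0 < b ->
  exists2 C : R, 0 <= C & forall x, `|q x| <= C * expR (b * dotv x x).
Proof.
move=> pq; elim: pq b => [c|i|f g _ IHf _ IHg|f g _ IHf _ IHg] b b0.
- exists `|c| => // x; rewrite ler_peMr// -expR0 ler_expR.
  by rewrite mulr_ge0 ?dotvv_ge0// ltW.
- have [C C0 HC] := @poly_le_expR R 'X b b0; exists C => // x.
  have := HC (x 0 i); rewrite hornerX => /le_trans; apply.
  rewrite ler_wpM2l// ler_expR (ler_wpM2l (ltW b0))// /dotv (bigD1 i)//= expr2 lerDl.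
  by apply: sumr_ge0 => j _; rewrite -expr2 sqr_ge0.
- have [C C0 HC] := IHf b b0; have [D D0 HD] := IHg b b0.
  exists (C + D); first exact: addr_ge0.
  by move=> x; rewrite mulrDl (le_trans (ler_normD _ _))// lerD.
- have b2 : 0 < b / 2 by rewrite divr_gt0.
  have [C C0 HC] := IHf _ b2; have [D D0 HD] := IHg _ b2.
  exists (C * D); first exact: mulr_ge0.
  move=> x; rewrite normrM [b](splitr b) mulrDl expRD mulrACA.
  by rewrite ler_pM.
Qed.

Lemma polygau_bounded f : polygau f -> exists M, forall x, `|f x| <= M.
Proof.
move=> [q pq ->]; have [C C0 HC] := polyfun_le_expR pq (pi_gt0 R).
exists C => x; rewrite normrM (ger0_norm (gauV_ge0 _ _)) gauVE.
apply: (le_trans (ler_wpM2r (expR_ge0 _) (HC x))).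
by rewrite -mulrA -expRD subrr expR0 mulr1.
Qed.

(** Polynomials times Gaussians are stable under derivation and bounded, and the
    weight |x|^k is at most (1 + |x|^2)^k, which the polynomial absorbs. *)
Lemma polygau_schwartz f : polygau f -> schwartz f.
Proof.
move=> pf s.
have {pf} pf : polygau (partials s f).
  by elim: s => [|i s IH] //=; exact: polygau_derive.
split=> [x|k]; first exact: polygau_differentiable.
have [q pq ->] := pf.
have [M HM] : exists M, forall x, `|(1 + dotv x x) ^+ k * q x * gauV pi x| <= M.
  apply: polygau_bounded; exists (fun x => (1 + dotv x x) ^+ k * q x) => //.
  apply: polyfunM => //; apply: polyfunX; apply: polyfunD.
    exact: polyfun_cst.
  exact: polyfun_dotvv.
exists M => x; apply: le_trans (HM x).
have d0 : 0 <= 1 + dotv x x by rewrite addr_ge0// dotvv_ge0.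
rewrite -mulrA [leRHS]normrM [X in _ <= X * _]ger0_norm ?exprn_ge0//.
rewrite ler_wpM2r// lerXn2r ?nnegrE ?sqrtr_ge0//.
rewrite -enorm_sqr; have := sqr_ge0 (enorm x - 1); have := sqr_ge0 (enorm x); nra.
Qed.

Lemma polygau_intble f : polygau f -> intble lebV f.
Proof.
move=> [q pq ->]; have pi2 : 0 < pi / 2 :> R by rewrite divr_gt0 ?pi_gt0.
have [C C0 HC] := polyfun_le_expR pq pi2.
apply: (@intble_le _ _ _ lebV _ (fun x => C * gauV (pi / 2) x)).
- apply: measurable_funM; first exact: polyfun_measurable.
  exact: measurable_gauV.
- move=> x; rewrite normrM (ger0_norm (gauV_ge0 _ _)) !gauVE.
  apply: (le_trans (ler_wpM2r (expR_ge0 _) (HC x))).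
  rewrite -[leLHS]mulrA -expRD; apply: ler_wpM2l => //; rewrite ler_expR.
  by rewrite le_eqVlt; apply/orP; left; apply/eqP; move: (pi : R) => P; field.
- by apply: intbleZ; exact: intble_gauV.
Qed.

Lemma polygau_sum (I : Type) (r : seq I) (F : I -> V -> R) :
  (forall i, polygau (F i)) -> polygau (fun x => \sum_(i <- r) F i x).
Proof.
move=> pF; elim: r => [|i r [q pq IH]].
  exists (fun=> 0); first exact: polyfun_cst.
  by apply/funext => x; rewrite big_nil mul0r.
have [p pp E] := pF i; exists (fun x => p x + q x); first exact: polyfunD.
by apply/funext => x; rewrite big_cons E (congr1 (@^~ x) IH) mulrDl.
Qed.

(** g is the Fourier transform of an even real Schwartz function. *)
Definition realizable g := exists f, [/\ polygau f, forall x, f (- x) = f x,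
  forall xi, cosT f xi = g xi & forall xi, sinT f xi = 0].

Lemma realizable_sum (I : Type) (r : seq I) (G : I -> V -> R) :
  (forall i, realizable (G i)) -> realizable (fun x => \sum_(i <- r) G i x).
Proof.
move=> rG; pose F i := projT1 (cid (rG i)).
have HF i : [/\ polygau (F i), forall x, F i (- x) = F i x,
  forall xi, cosT (F i) xi = G i xi & forall xi, sinT (F i) xi = 0].
  exact: (projT2 (cid (rG i))).
have iF i : intble lebV (F i) by apply: polygau_intble; case: (HF i).
exists (fun x => \sum_(i <- r) F i x); split.
- by apply: polygau_sum => i; case: (HF i).
- by move=> x; apply: eq_bigr => i _; case: (HF i).
- move=> xi; transitivity (\sum_(i <- r) cosT (F i) xi); last first.
    by apply: eq_bigr => i _; case: (HF i).
  rewrite -Rintegral_sum; last by move=> i; exact: intble_cosT.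
  by apply: eq_Rintegral => x _; rewrite mulr_sumr.
- move=> xi; transitivity (\sum_(i <- r) sinT (F i) xi); last first.
    by apply: big1 => i _; case: (HF i).
  rewrite -Rintegral_sum; last by move=> i; exact: intble_sinT.
  by apply: eq_Rintegral => x _; rewrite mulr_sumr.
Qed.

(** The function is a product of one-dimensional Hermite functions. *)
Lemma realizable_monogau m : realizable (monogau pi m).
Proof.
pose F (i : 'I_n) (t : R) := (hermite (m i)).[t] * gau pi t.
have iF i : intble (@lebesgue_measure R) (F i) by apply: intble_poly_gau; exact: pi_gt0.
have trig (xi : V) := tensor_trig iF (fun i : 'I_n => gsin_hermite (m i) (xi 0 i)).
have dotE (xi x : V) : 2 * pi * dotv xi x = \sum_i 2 * pi * xi 0 i * x 0 i.
  by rewrite /dotv mulr_sumr; apply: eq_bigr => i _; ring.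
exists (fun x => \prod_i F i (x 0 i)); split.
- exists (fun x => \prod_i (hermite (m i)).[x 0 i]).
    by apply: polyfun_prod => i; exact: polyfun_horner.
  by apply/funext => x; rewrite /F big_split.
- by move=> x; apply: eq_bigr => i _; rewrite mxE /F hermiteN /gau sqrrN.
- move=> xi; have [E _] := trig xi.
  transitivity (\prod_i gcos pi (hermite (m i)) (2 * pi * xi 0 i)).
    rewrite -E; apply: eq_Rintegral => x _.
    by rewrite dotE.
  by apply: eq_bigr => i _; rewrite gcos_hermite.
- move=> xi; have [_ E] := trig xi.
  by rewrite -E; apply: eq_Rintegral => x _; rewrite dotE.
Qed.

(** |xi|^(2k) is a sum of monomials with even exponents. *)
Lemma realizable_radgau k : realizable (radgau pi k).
Proof.
suff H m : realizable (fun x => dotv x x ^+ k * monogau pi m x).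
  have := H (fun=> 0%N); congr realizable.
  by apply/funext => x; rewrite monogau0.
elim: k m => [|k IH] m.
  have := realizable_monogau m; congr realizable.
  by apply/funext => x; rewrite mul1r.
have := @realizable_sum _ (index_enum 'I_n) _ (fun i => IH (raise m i)).
congr realizable; apply/funext => x.
by rewrite dotv_monogau.
Qed.

End polynomial_gaussians.

(** * Fourier multipliers with real symbols *)
Section multipliers.
Context {R : realType}.
Variable n : nat.
Notation leb := (@lebesgue_measure R).
Notation V := 'rV[R]_n.
Notation lebV := (@lebesgue_rV R n).
Implicit Types (x y : V).
Local Open Scope complex_scope.

Lemma fourier_real (f g : V -> R) : intble lebV f ->
  (forall xi, cosT f xi = g xi) -> (forall xi, sinT f xi = 0) ->
  forall xi, fourier (fun x => (f x)%:C) xi = (g xi)%:C.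
Proof.
move=> fi cf sf xi; rewrite /fourier /Cintegral; congr (_ +i* _).
  rewrite -cf; apply: eq_Rintegral => x _ /=.
  by rewrite cosN dotvC mulr0 subr0.
transitivity (- 1 * sinT f xi); last by rewrite sf mulr0.
rewrite /sinT -RintegralZl//; last exact: intble_sinT.
apply: eq_Rintegral => x _ /=.
by rewrite sinN dotvC mulr0 add0r mulN1r mulNr.
Qed.

Lemma multiplierE (m : R -> R) (f g : V -> R) x :
  (forall xi, fourier (fun x => (f x)%:C) xi = (g xi)%:C) ->
  multiplier m f x =
    cosT (fun xi => m (4 * pi ^+ 2 * enorm xi ^+ 2) * g xi) x +i*
    sinT (fun xi => m (4 * pi ^+ 2 * enorm xi ^+ 2) * g xi) x.
Proof.
move=> fg; rewrite /multiplier /inv_fourier /Cintegral; congr (_ +i* _).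
  by apply: eq_Rintegral => xi _; rewrite fg /=; ring.
by apply: eq_Rintegral => xi _; rewrite fg /=; ring.
Qed.

Lemma normCE (a b : R) : normC (a +i* b) = Num.sqrt (a ^+ 2 + b ^+ 2).
Proof. by rewrite /normC normc_def. Qed.

(** [plancherel_le], applied to the symbol times the Fourier transform of f. *)
Lemma sobolev_norm_le s (f g : V -> R) (G : V -> R) :
  (forall xi, fourier (fun x => (f x)%:C) xi = (g xi)%:C) ->
  G = (fun xi => (1 + 4 * pi ^+ 2 * enorm xi ^+ 2) `^ (s / 2) * g xi) ->
  intble lebV G -> intble lebV (fun x => G x ^+ 2) ->
  (sobolev_norm s f <= (Num.sqrt (\int[lebV]_x (G x ^+ 2)))%:E)%E.
Proof.
move=> fg GE iG iG2; rewrite /sobolev_norm unlock.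
have E x : (`|(normC (multiplier (fun l => (1 + l) `^ (s / 2)) f x))%:E| `^ 2 =
    (cosT G x ^+ 2 + sinT G x ^+ 2)%:E)%E.
  rewrite (multiplierE _ _ fg) -GE normCE.
  rewrite abse_EFin ger0_norm ?sqrtr_ge0// poweR_EFin powR_mulrn ?sqrtr_ge0//.
  by rewrite sqr_sqrtr// addr_ge0 ?sqr_ge0.
under eq_integral do rewrite E.
have := plancherel_le iG iG2; rewrite -(EFin_Rintegral iG2) => P.
have P0 : 0 <= \int[lebV]_x (G x ^+ 2) by apply: Rintegral_ge0 => x _; exact: sqr_ge0.
rewrite -powR12_sqrt// -poweR_EFin; apply: gt0_ler_poweR => //.
- by rewrite in_itv/= leey andbT; apply: integral_ge0 => x _; rewrite lee_fin addr_ge0 ?sqr_ge0.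
- by rewrite in_itv/= lee_fin P0 leey.
Qed.

(** The right-hand side dominates the absolute value of the real part. *)
Lemma normC_wave_ge (f g : V -> R) x t :
  (forall xi, fourier (fun x => (f x)%:C) xi = (g xi)%:C) ->
  `|\int[lebV]_xi (cos (2 * pi * dotv x xi) *
      (cos (2 * pi * t * enorm xi - (n%:R - 1) / 4 * pi) * g xi))| <=
  normC (wave f x t).
Proof.
move=> fg; rewrite /wave (multiplierE _ _ fg) normCE.
set c := cosT _ _; rewrite [X in `|X|](_ : _ = c); last first.
  apply: eq_Rintegral => xi _; congr (_ * (cos (_ - _) * _)).
  rewrite (_ : 4 * pi ^+ 2 * enorm xi ^+ 2 = (2 * pi * enorm xi) ^+ 2); last by ring.
  rewrite sqrtr_sqr ger0_norm ?mulr_ge0 ?pi_ge0 ?sqrtr_ge0//; ring.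
by rewrite -sqrtr_sqr ler_wsqrtr// lerDl sqr_ge0.
Qed.

End multipliers.

(** * Focusing of the wave at the origin *)
Section wave_lower_bound.
Context {R : realType}.

Lemma cos_lip (u v : R) : `|cos u - cos v| <= `|u - v|.
Proof.
wlog vu : u v / v <= u.
  move=> H; case/orP: (le_total v u) => [/H//|/H].
  by rewrite distrC [X in _ <= X]distrC.
have [c _ ->] := @MVT_segment R (@cos R) (fun x => - sin x) v u vu
  (fun x _ => is_derive_cos x) (continuous_subspaceT (@continuous_cos R)).
by rewrite normrM ler_piMl// normrN ler_norm_sin.
Qed.

Lemma pi_le4 : pi <= 4 :> R.
Proof. by have := pihalf_lt2 R; lra. Qed.

Variable n : nat.
Hypothesis n_gt0 : (0 < n)%N.
Notation V := 'rV[R]_n.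
Notation lebV := (@lebesgue_rV R n).

Lemma dotv_axis (i : 'I_n) (c : R) (xi : V) : `|dotv (c *: delta_mx 0 i) xi| <= `|c| * enorm xi.
Proof.
rewrite /dotv (bigD1 i)//= big1 ?addr0; last first.
  by move=> j /negbTE ji; rewrite !mxE eqxx/= eq_sym eq_sym ji mulr0 mul0r.
by rewrite !mxE !eqxx mulr1 normrM ler_wpM2l// enorm_coord.
Qed.

(** The mean of |xi|^2 under [radgau pi k]; the next two lemmas say that the
    variance is [rad2 k / pi], so that |xi| deviates from the square root of
    [rad2 k] by O(1). *)
Definition rad2 (k : nat) : R := gshape n k / pi.

Lemma rad2_gt0 k : 0 < rad2 k.
Proof.
by rewrite divr_gt0 ?pi_gt0// gshape_gt0.
Qed.

Lemma rad2_moment1 k : rmoment n pi k.+1 = rad2 k * rmoment n pi k.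
Proof. by rewrite rmomentS// pi_gt0. Qed.

Lemma rad2_moment2 k :
  rmoment n pi k.+2 = (rad2 k + pi^-1) * (rad2 k * rmoment n pi k).
Proof.
rewrite -rad2_moment1 rmomentS ?pi_gt0//; congr (_ * _).
by rewrite /rad2 /gshape -natr1; move: (pi : R) (pi_gt0 R) => P P0; field; rewrite gt_eqF.
Qed.

(** Replacing the phases by their values at x = 0 and |xi| = r costs at most
    2 pi |c| |xi| + 2 pi t | |xi| - r |, which is dominated by a quadratic
    polynomial in |xi|^2; the first three moments evaluate its integral. *)
Lemma wave_integral_close k (i : 'I_n) (c t phi : R) (r := Num.sqrt (rad2 k)) :
  `|c| * r <= 64^-1 -> 0 <= t <= 64^-1 ->
  `|\int[lebV]_xi (cos (2 * pi * dotv (c *: delta_mx 0 i) xi) *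
      (cos (2 * pi * t * enorm xi - phi) * radgau pi k xi)) -
    cos (2 * pi * t * r - phi) * rmoment n pi k| <= rmoment n pi k / 4.
Proof.
move=> cr /andP[t0 t1]; have pi0 := pi_gt0 R.
set x := c *: _; set A := rmoment n pi k.
have pi2 : 0 <= 2 * pi :> R by rewrite mulr_ge0// ltW.
have r0 : 0 < r by rewrite sqrtr_gt0 rad2_gt0.
have r2 : r ^+ 2 = rad2 k by rewrite sqr_sqrtr// ltW// rad2_gt0.
have A0 : 0 < A by exact: rmoment_gt0.
have ig j : intble lebV (radgau pi j) by exact: intble_radgau.
have mg := intble_measurable (ig k).
have mcos (f : V -> R) : measurable_fun setT f -> measurable_fun setT (fun y => cos (f y)).
  by move=> mf; exact: (measurableT_comp measurable_cosR mf).
have mdot : measurable_fun setT (fun y : V => 2 * pi * dotv x y).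
  by apply: measurable_funM => //; exact: measurable_dotv.
have mE : measurable_fun setT (@enorm R n).
  apply: (measurableT_comp (continuous_measurable_fun (@sqrt_continuous R))).
  exact: measurable_dotv.
have i1 : intble lebV (fun xi => cos (2 * pi * t * enorm xi - phi) * radgau pi k xi).
  apply: (@intble_bdM R _ _ lebV (fun xi => cos (2 * pi * t * enorm xi - phi)) (radgau pi k)) => //.
    by apply: mcos; apply: measurable_funB => //; apply: measurable_funM.
  by move=> xi; exact: ler_norm_cos.
have i2 : intble lebV (fun xi => cos (2 * pi * dotv x xi) *
    (cos (2 * pi * t * enorm xi - phi) * radgau pi k xi)).
  apply: (@intble_bdM R _ _ lebV (fun xi => cos (2 * pi * dotv x xi))
    (fun xi => cos (2 * pi * t * enorm xi - phi) * radgau pi k xi)) => //.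
    exact: mcos.
  by move=> xi; exact: ler_norm_cos.
have i3 : intble lebV (fun xi => cos (2 * pi * t * r - phi) * radgau pi k xi).
  exact: intbleZ.
rewrite -RintegralZl// -RintegralB//.
(* The coefficients of the bound by AM-GM:
   |xi| <= (|xi|^2 / r + r) / 2 and
   | |xi| - r | <= (1 + (|xi|^2 - r^2)^2 / r^2) / 2. *)
pose a0 := pi * `|c| * r + pi * t * (1 + rad2 k).
pose a1 := pi * `|c| / r - 2 * pi * t.
pose a2 := pi * t / rad2 k.
pose H (xi : V) := (a0 * radgau pi k xi + a1 * radgau pi k.+1 xi) + a2 * radgau pi k.+2 xi.
have iH01 : intble lebV (fun xi => a0 * radgau pi k xi + a1 * radgau pi k.+1 xi).
  by apply: intbleD; exact: intbleZ.
have iH : intble lebV H by apply: intbleD => //; exact: intbleZ.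
have HI : \int[lebV]_xi H xi = pi * (`|c| * r) * A * 2 + t * (pi + 1) * A.
  rewrite RintegralD//; last exact: intbleZ.
  rewrite RintegralD//; [|exact: intbleZ|exact: intbleZ].
  rewrite !RintegralZl// -/(rmoment n pi k) -/(rmoment n pi k.+1) -/(rmoment n pi k.+2).
  rewrite rad2_moment2 rad2_moment1 -/A /a0 /a1 /a2 -r2.
  by move: (pi : R) pi0 => P P0; field; rewrite !gt_eqF.
apply: (le_trans (le_normr_Rintegral _ _)) => //; first exact: intbleB.
apply: (@le_trans _ _ (\int[lebV]_xi H xi)).
  apply: le_Rintegral => //.
    have := integrable_norm (intbleB i2 i3); by [].
  move=> xi _.
  rewrite mulrA -mulrBl normrM (ger0_norm (radgau_ge0 _ _ _)).
  have -> : H xi = (a0 + a1 * dotv xi xi + a2 * dotv xi xi ^+ 2) * radgau pi k xi.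
    have e1 := dotv_radgau pi k 1 xi; have e2 := dotv_radgau pi k 2 xi.
    by rewrite addn1 in e1; rewrite addn2 in e2; rewrite /H -e1 -e2 expr1; ring.
  rewrite ler_wpM2r ?radgau_ge0//.
  set e := enorm xi; have e0 : 0 <= e by exact: sqrtr_ge0.
  have B1 : `|cos (2 * pi * dotv x xi) - 1| <= 2 * pi * (`|c| * e).
    rewrite -{2}cos0 (le_trans (cos_lip _ _))// subr0 normrM.
    by rewrite (ger0_norm pi2) (ler_wpM2l pi2)// dotv_axis.
  have B2 : `|cos (2 * pi * t * e - phi) - cos (2 * pi * t * r - phi)| <= 2 * pi * t * `|e - r|.
    rewrite (le_trans (cos_lip _ _))// opprB addrA subrK -mulrBr normrM.
    by rewrite (ger0_norm (mulr_ge0 pi2 t0)).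
  rewrite (_ : _ - _ = (cos (2 * pi * dotv x xi) - 1) * cos (2 * pi * t * e - phi) +
     (cos (2 * pi * t * e - phi) - cos (2 * pi * t * r - phi))); last by ring.
  apply: (le_trans (ler_normD _ _)).
  apply: (@le_trans _ _ (2 * pi * (`|c| * e) + 2 * pi * t * `|e - r|)).
    rewrite lerD// normrM (le_trans _ B1)// ler_piMr// ler_norm_cos //.
  have C1 : e <= (e ^+ 2 / r + r) / 2.
    rewrite ler_pdivlMr// -subr_ge0.
    rewrite (_ : _ - _ = (e - r) ^+ 2 / r); last by field; rewrite gt_eqF.
    by rewrite divr_ge0 ?sqr_ge0// ltW.
  have C2 : `|e - r| <= (1 + (e ^+ 2 - r ^+ 2) ^+ 2 / r ^+ 2) / 2.
    apply: (@le_trans _ _ (`|e ^+ 2 - r ^+ 2| / r)).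
      rewrite ler_pdivlMr// subr_sqr normrM ler_wpM2l//.
      by rewrite ger0_norm ?lerDr// addr_ge0// ltW.
    set w := `|e ^+ 2 - r ^+ 2| / r.
    have -> : (e ^+ 2 - r ^+ 2) ^+ 2 / r ^+ 2 = w ^+ 2.
      by rewrite /w exprMn exprVn real_normK ?num_real.
    by have := sqr_ge0 (w - 1); nra.
  rewrite -enorm_sqr -/e.
  have -> : a0 + a1 * e ^+ 2 + a2 * (e ^+ 2) ^+ 2 =
      2 * pi * (`|c| * ((e ^+ 2 / r + r) / 2)) +
      2 * pi * t * ((1 + (e ^+ 2 - r ^+ 2) ^+ 2 / r ^+ 2) / 2).
    rewrite /a0 /a1 /a2 -r2.
    by move: (pi : R) => P; field; rewrite gt_eqF.
  rewrite lerD//.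
    by rewrite (ler_wpM2l pi2)// ler_wpM2l.
  by rewrite (ler_wpM2l (mulr_ge0 pi2 t0)).
rewrite HI.
have h1 : pi * (`|c| * r) <= 4 / 64.
  by apply: ler_pM; [exact: ltW|rewrite mulr_ge0// ltW|exact: pi_le4|].
have h2 : t * (pi + 1) <= 64^-1 * 5.
  by apply: ler_pM => //; [rewrite addr_ge0// ltW|have := pi_le4; lra].
rewrite (_ : _ + _ = A * (pi * (`|c| * r) * 2 + t * (pi + 1))); last by ring.
by rewrite ler_pM2l//; lra.
Qed.

End wave_lower_bound.

(** * Lower bounds for integrals *)
Section monotone.
Local Open Scope ereal_scope.
Context d (T : measurableType d) (R : realType).
Variable mu : {measure set T -> \bar R}.

(** The integral of a nonnegative function is a supremum over the simple functions
    below it, one of which is c on E; this applies to the wave as it stands,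
    measurable in (x, t) or not. *)
Lemma ge0_le_integral_set (D E : set T) (f : T -> \bar R) (c : R) :
  measurable D -> measurable E -> E `<=` D ->
  (0 <= c)%R -> (forall x, D x -> 0 <= f x) -> (forall x, E x -> c%:E <= f x) ->
  c%:E * mu E <= \int[mu]_(x in D) f x.
Proof.
move=> mD mE ED c0 f0 fc.
have -> : c%:E * mu E = \int[mu]_(x in D) (c%:E * (\1_E x)%:E).
  rewrite ge0_integralZl//; last first.
    by apply/measurable_EFinP; exact: measurable_indic.
  by rewrite integral_indic// setIidl.
have g0 x : D x -> 0 <= c%:E * (\1_E x)%:E by move=> _; rewrite mule_ge0// lee_fin.
rewrite !ge0_integralE//; apply: ge_ereal_sup => _ [h/= hg <-].
apply: ereal_sup_ubound; exists h => //= x; apply: (le_trans (hg x)).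
rewrite !patchE; case: ifPn => // /set_mem Dx; rewrite indicE.
have [/set_mem /fc|_] := boolP (x \in E); first by rewrite mule1.
by rewrite mule0 f0.
Qed.

End monotone.

(** * Times at which the phase is favourable *)
Section times_of_large_cosine.
Context {R : realType}.
Notation leb := (@lebesgue_measure R).

Definition large_cos (b phi : R) : set R :=
  `[0, 64^-1]%classic `&` [set t | 2^-1 <= `|cos (b * t - phi)|].

Lemma is_derive_cos2_primitive (b phi : R) (t : R) : b != 0 ->
  is_derive t 1 (fun t => t / 2 + sin (b * t - phi) * cos (b * t - phi) / (2 * b))
    (cos (b * t - phi) ^+ 2).
Proof.
move=> b0.
have dl : is_derive t 1 (fun t : R => b * t - phi) b.
  have := is_deriveB (@is_deriveZ _ _ _ id b t 1 1 (is_derive_id _ _)) (is_derive_cst phi t 1).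
  by move=> /is_derive_eq; apply; rewrite /GRing.scale/= mulr1 subr0.
have ds : is_derive t 1 (fun t => sin (b * t - phi)) (cos (b * t - phi) * b).
  exact: (@is_derive1_comp R sin _ t _ _ (is_derive_sin _) dl).
have dc : is_derive t 1 (fun t => cos (b * t - phi)) (- sin (b * t - phi) * b).
  exact: (@is_derive1_comp R cos _ t _ _ (is_derive_cos _) dl).
have d1 : is_derive t 1 (fun t : R => t / 2) 2^-1.
  have := is_deriveM (is_derive_id t 1) (is_derive_cst (2^-1 : R) t 1).
  by move=> /is_derive_eq; apply; rewrite /GRing.scale/=; ring.
have := is_deriveD d1 (is_deriveM (is_deriveM ds dc) (is_derive_cst ((2 * b)^-1) t 1)).
move=> /is_derive_eq; apply; rewrite /GRing.scale/=.
have := cos2Dsin2 (b * t - phi).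
move: (cos _) (sin _) => C S CS.
rewrite (_ : C ^+ 2 = 2^-1 * (C ^+ 2 + S ^+ 2) + 2^-1 * (C ^+ 2 - S ^+ 2)); last by field.
by rewrite CS; field.
Qed.

Lemma measurable_large_cos b phi : measurable (large_cos b phi).
Proof.
apply: measurableI; first exact: measurable_itv.
have mf : measurable_fun setT (fun t : R => `|cos (b * t - phi)|).
  apply: measurableT_comp => //; apply: (measurableT_comp measurable_cosR).
  by apply: measurable_funB => //; apply: measurable_funM.
have := mf measurableT `[2^-1, +oo[%classic (measurable_itv _).
rewrite setTI; congr (measurable _).
by apply/seteqP; split => t /=; rewrite in_itv/= andbT.
Qed.

(** The square of the cosine is at most 1/4 off [large_cos], while its mean over
    [0, 1/64] is 1/2 up to an error O(1/b). *)
Lemma large_cos_measure b phi : 512 <= b -> ((512^-1 : R)%:E <= leb (large_cos b phi))%E.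
Proof.
move=> b512; have b0 : 0 < b by lra.
have bn0 : b != 0 by rewrite gt_eqF.
pose f (t : R) := cos (b * t - phi) ^+ 2.
pose F (t : R) := t / 2 + sin (b * t - phi) * cos (b * t - phi) / (2 * b).
have dF (t : R) : is_derive t 1 F (f t) by exact: is_derive_cos2_primitive.
have cF := is_derive_continuous dF.
have cf : continuous f.
  move=> t; apply: (@continuous_comp _ _ _ (fun t : R => cos (b * t - phi)) (fun x => x ^+ 2)).
    apply: continuous_comp; last exact: continuous_cos.
    by apply: cvgB; [apply: cvgM; [exact: cvg_cst|exact: cvg_id]|exact: cvg_cst].
  exact: exprn_continuous.
have I : (\int[leb]_(t in `[0%R, (64^-1)%R]) (f t)%:E = (F 64^-1)%:E - (F 0)%:E)%E.
  apply: continuous_FTC2.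
  - by rewrite invr_gt0.
  - exact: continuous_subspaceT.
  - split; [by move=> x _; case: (dF x)|exact/cvg_at_right_filter/cF|exact/cvg_at_left_filter/cF].
  - by move=> x _; rewrite derive1E; have [_ ->] := dF x.
have mf : measurable_fun setT f by exact: continuous_measurable_fun.
have mE := measurable_large_cos b phi.
have U : (\int[leb]_(t in `[0%R, (64^-1)%R]) (f t)%:E <=
    \int[leb]_(t in `[0%R, (64^-1)%R]) ((4^-1)%:E + (\1_(large_cos b phi) t)%:E))%E.
  apply: ge0_le_integral => //.
  - by move=> t _; rewrite lee_fin sqr_ge0.
  - by apply/measurable_EFinP; exact: measurable_funTS.
  - apply: emeasurable_funD; first exact: measurable_cst.
    by apply/measurable_EFinP; exact: measurable_indic.
  - move=> t t01; rewrite -EFinD lee_fin indicE.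
    have [tE|tE] := boolP (t \in large_cos b phi).
      rewrite (@le_trans _ _ 1)//; last by rewrite lerDr invr_ge0.
      by rewrite /f -real_normK ?num_real// exprn_ile1// ler_norm_cos.
    rewrite addr0 /f -real_normK ?num_real//.
    have : `|cos (b * t - phi)| < 2^-1.
      by rewrite ltNge; apply: contra tE => tE; rewrite inE; split.
    by have := normr_ge0 (cos (b * t - phi)); nra.
have V : (\int[leb]_(t in `[0%R, (64^-1)%R]) ((4^-1)%:E + (\1_(large_cos b phi) t)%:E) =
    (4^-1 * 64^-1)%:E + leb (large_cos b phi))%E.
  rewrite ge0_integralD//; last by apply/measurable_EFinP; exact: measurable_indic.
  rewrite integral_cst// integral_indic// setIidl; last by move=> t [].
  by rewrite /= lebesgue_measure_itv/= lte_fin invr_gt0 ltr0n/= oppr0 adde0 -EFinM.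
rewrite I V -EFinB in U.
have L : 256^-1 - 512^-1 + 4^-1 * 64^-1 <= F 64^-1 - F 0.
  have H t : `|sin (b * t - phi) * cos (b * t - phi) / (2 * b)| <= 1024^-1.
    rewrite normrM normrM (_ : 1024^-1 = 1 * 1 * (1024^-1 : R)); last by ring.
    apply: ler_pM => //; first by apply: ler_pM => //; [exact: ler_norm_sin|exact: ler_norm_cos].
    have b20 : 0 < 2 * b by rewrite mulr_gt0.
    rewrite ger0_norm; last by rewrite invr_ge0 ltW.
    by rewrite lef_pV2; [lra|rewrite posrE; lra|rewrite posrE; lra].
  rewrite /F; move: (H 64^-1) (H 0); rewrite !ler_norml => /andP[h1 _] /andP[_ h2].
  by lra.
have U' : ((256^-1 - 512^-1 + 4^-1 * 64^-1 : R)%:E <= (4^-1 * 64^-1)%:E + leb (large_cos b phi))%E.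
  by apply: le_trans U; rewrite lee_fin.
rewrite -leeBlDl// -EFinB in U'; apply: le_trans U'.
by rewrite lee_fin; lra.
Qed.

End times_of_large_cosine.

(** * A measure of dimension 1/N on an axis *)
Section axis_measure.
Context {R : realType}.
Variables (n : nat) (i0 : 'I_n) (N : nat).
Hypothesis N_gt0 : (0 < N)%N.
Notation leb := (@lebesgue_measure R).
Notation V := 'rV[R]_n.

Definition axis (c : R) : V := c *: delta_mx 0 i0.

Lemma axis_coord c : axis c 0 i0 = c.
Proof. by rewrite !mxE !eqxx mulr1. Qed.

Lemma axisN c : axis (- c) = - axis c.
Proof. by rewrite /axis scaleNr. Qed.

Lemma continuous_axis : continuous axis.
Proof. by move=> c; exact: scalel_continuous. Qed.

(** Under u |-> u^N, intervals of length r have preimages of length r^(1/N) at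
    most; this gives the image measure the dimension 1/N. *)
Definition posbranch (u : R) : V := axis (u ^+ N).
Definition negbranch (u : R) : V := axis (- u ^+ N).

Lemma measurable_axis (f : R -> R) : measurable_fun setT f ->
  measurable_fun setT (fun u : measurableTypeR R => axis (f u)).
Proof.
move=> mf; apply: measurable_fun_mx => i j.
rewrite (_ : (fun t => _) = fun t => f t * delta_mx 0 i0 i j); last first.
  by apply/funext => t; rewrite !mxE.
exact: measurable_funM.
Qed.

Lemma measurable_posbranch : measurable_fun setT (posbranch : measurableTypeR R -> V).
Proof. by apply: measurable_axis; exact: measurable_funX. Qed.

Lemma measurable_negbranch : measurable_fun setT (negbranch : measurableTypeR R -> V).
Proof.
by apply: measurable_axis; apply: measurableT_comp => //; exact: measurable_funX.
Qed.

Definition unit_leb : {measure set (measurableTypeR R) -> \bar R} :=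
  mrestr leb (measurable_itv `[0, 1]).

Definition axis_measure : {measure set V -> \bar R} :=
  measure_add
    (measure_function_pushforward__canonical__measure_function_Measure unit_leb measurable_posbranch)
    (measure_function_pushforward__canonical__measure_function_Measure unit_leb measurable_negbranch).

Lemma axis_measureE A : axis_measure A =
  (leb (posbranch @^-1` A `&` `[0%R, 1%R]) + leb (negbranch @^-1` A `&` `[0%R, 1%R]))%E.
Proof. exact: measure_addE. Qed.

Lemma measurable_preim (f : measurableTypeR R -> V) A : measurable_fun setT f ->
  measurable A -> measurable (f @^-1` A `&` `[0%R, 1%R] : set (measurableTypeR R)).
Proof.
move=> mf mA; apply: measurableI; last exact: measurable_itv.
by rewrite -[X in measurable X]setTI; exact: mf.
Qed.

Lemma even_axis_measure : even_measure axis_measure.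
Proof.
move=> A mA; rewrite !axis_measureE addeC; congr (leb (_ `&` _) + leb (_ `&` _))%E.
  by apply/funext => u; rewrite /preimage/= /negbranch axisN opprK.
by apply/funext => u; rewrite /preimage/= /negbranch axisN.
Qed.

Lemma open_measurable_rV (U : set V) : open U -> measurable U.
Proof. by move=> oU; exact: sub_sigma_algebra. Qed.

Lemma closed_measurable_rV (U : set V) : closed U -> measurable U.
Proof.
move=> cU; rewrite -(setCK U); apply: measurableC; apply: open_measurable_rV.
exact: closed_openC.
Qed.

Definition axis_segment (rho : R) : set V := axis @` `[- rho, rho]%classic.

Lemma compact_axis_segment rho : compact (axis_segment rho).
Proof.
apply: continuous_compact; last exact: segment_compact.
by apply: continuous_subspaceT; exact: continuous_axis.
Qed.

Lemma closed_axis_segment rho : closed (axis_segment rho).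
Proof.
apply: compact_closed; last exact: compact_axis_segment.
exact: norm_hausdorff.
Qed.

(** The support is closed, and the complement of the segment from -1 to 1 on the
    axis is an open null set. *)
Lemma compact_support_axis_measure : compact (msupport axis_measure).
Proof.
apply: (@subclosed_compact _ _ (axis_segment 1)).
- move=> x clx U oU Ux; have [y [sy Uy]] := clx U (open_nbhs_nbhs (conj oU Ux)).
  exact: sy.
- exact: compact_axis_segment.
- move=> x sx; apply: contrapT => nx.
  have := sx (~` axis_segment 1) (closed_openC (@closed_axis_segment 1)) nx.
  rewrite axis_measureE.
  rewrite (_ : posbranch @^-1` _ `&` _ = set0); last first.
    apply/seteqP; split => // u [+ /=]; rewrite in_itv/= => + /andP[u0 u1]; apply.
    exists (u ^+ N) => //=; rewrite in_itv/= exprn_ile1// andbT.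
    by rewrite (le_trans _ (exprn_ge0 _ u0))// lerN10.
  rewrite (_ : negbranch @^-1` _ `&` _ = set0); last first.
    apply/seteqP; split => // u [+ /=]; rewrite in_itv/= => + /andP[u0 u1]; apply.
    exists (- u ^+ N) => //=; rewrite in_itv/= lerN2 exprn_ile1//=.
    by rewrite (@le_trans _ _ 0)// oppr_le0 exprn_ge0.
  by rewrite measure0 adde0 ltxx.
Qed.

Lemma axis_measure_segment (s : R) : 0 <= s <= 1 ->
  (s%:E <= axis_measure (axis_segment (s ^+ N)))%E.
Proof.
move=> /andP[s0 s1]; rewrite axis_measureE.
apply: (@le_trans _ _ (leb (posbranch @^-1` (axis_segment (s ^+ N)) `&` `[0%R, 1%R])));
  last by rewrite leeDl.
apply: (@le_trans _ _ (leb (`[0, s]%classic : set R))).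
  rewrite lebesgue_measure_itv/= lte_fin; case: ltP => [_|s0']; first by rewrite oppr0 adde0.
  by rewrite lee_fin.
apply: le_measure; rewrite ?inE.
- exact: measurable_itv.
- apply: measurable_preim; first exact: measurable_posbranch.
  by apply: closed_measurable_rV => x; exact: closed_axis_segment.
- move=> u /=; rewrite in_itv/= => /andP[u0 us]; split; last first.
    by rewrite /= in_itv/= u0 (le_trans us).
  exists (u ^+ N) => //=; rewrite in_itv/= lerXn2r// andbT.
  by rewrite (@le_trans _ _ 0) ?exprn_ge0// oppr_le0 exprn_ge0.
Qed.

(** Superadditivity of the N-th power. *)
Lemma exprB_le (u v : R) : 0 <= v -> v <= u -> (u - v) ^+ N <= u ^+ N - v ^+ N.
Proof.
move=> v0 vu; rewrite lerBrDr.
have H k (a b : R) : 0 <= a -> 0 <= b -> a ^+ k.+1 + b ^+ k.+1 <= (a + b) ^+ k.+1.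
  move=> a0 b0; elim: k => [|k IH]; first by rewrite !expr1.
  rewrite [leRHS]exprS (le_trans _ (ler_wpM2l (addr_ge0 a0 b0) IH))//.
  rewrite mulrDl !mulrDr !exprS -!exprS addrACA.
  by rewrite lerD// ?lerDl ?lerDr mulr_ge0 ?exprn_ge0.
case: N N_gt0 => // k _.
by rewrite (le_trans (H k _ _ _ v0)) ?subr_ge0// subrK.
Qed.

Lemma eball_measurable (x : V) r : measurable (eball x r).
Proof.
have mf : measurable_fun setT (fun y : V => enorm (y - x)).
  apply: (measurableT_comp (continuous_measurable_fun (@sqrt_continuous R))).
  have mB : measurable_fun setT (fun y : V => y - x).
    apply: measurable_fun_mx => i j; under eq_fun do rewrite !mxE.
    by apply: measurable_funB => //; rewrite (ord1 i); exact: measurable_coord.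
  exact: measurable_dotv.
have := mf measurableT `]-oo, r[%classic (measurable_itv _).
rewrite setTI; congr (measurable _).
Qed.

Lemma root_dist_le (u v r : R) : 0 <= u -> 0 <= v -> 0 < r ->
  `|u ^+ N - v ^+ N| < r -> `|u - v| <= r `^ N%:R^-1.
Proof.
move=> u0 v0 r0 H.
have {}H : `|u - v| ^+ N <= r.
  wlog vu : u v u0 v0 H / v <= u.
    move=> HW; case/orP: (le_total v u) => [/HW|vu]; first exact.
    by rewrite distrC HW// distrC.
  rewrite (le_trans _ (ltW H))// ger0_norm ?subr_ge0// (le_trans (exprB_le v0 vu))//.
  exact: ler_norm.
have -> : `|u - v| = (`|u - v| ^+ N) `^ N%:R^-1.
  by rewrite -powR_mulrn// -powRrM divff ?powRr1// pnatr_eq0 -lt0n.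
apply: ge0_ler_powR => //; rewrite ?nnegrE ?invr_ge0 ?exprn_ge0//.
exact: ltW.
Qed.

(** Two points of the preimage of a ball of radius r differ by at most
    (2 r)^(1/N), by [root_dist_le]; so the preimage lies in an interval. *)
Lemma branch_ball (f : measurableTypeR R -> V) (x : V) (r : R) : 0 < r ->
  measurable_fun setT f ->
  (forall u v : R, 0 <= u -> 0 <= v -> `|u ^+ N - v ^+ N| = `|f u 0 i0 - f v 0 i0|) ->
  (leb (f @^-1` (eball x r) `&` `[0%R, 1%R]) <= (2 * (2 * r) `^ N%:R^-1)%:E)%E.
Proof.
move=> r0 mf fE; set S := _ `&` _; set del := (2 * r) `^ N%:R^-1.
have del0 : 0 < del by rewrite powR_gt0// mulr_gt0.
have [->|/set0P] := eqVneq S set0; last first.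
  move=> [v [vB]] /=; rewrite in_itv/= => /andP[v0 v1].
  apply: (@le_trans _ _ (leb (`[v - del, v + del]%classic : set R))).
    apply: le_measure; rewrite ?inE.
    - apply: measurable_preim => //; exact: eball_measurable.
    - exact: measurable_itv.
    - move=> u [uB] /=; rewrite !in_itv/= => /andP[u0 u1].
      rewrite -ler_distl; apply: root_dist_le => //; first by rewrite mulr_gt0.
      rewrite fE// (_ : _ - _ = (f u - x) 0 i0 - (f v - x) 0 i0); last by rewrite !mxE; ring.
      rewrite (le_lt_trans (ler_normB _ _))// [2 * r]mulrDl mul1r.
      by rewrite ltrD// (le_lt_trans (enorm_coord _ _)).
  rewrite lebesgue_measure_itv/= lte_fin ifT; last by rewrite ltrBlDr -addrA ltrDl addr_gt0.
  by rewrite -EFinB lee_fin; lra.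
by rewrite measure0 lee_fin mulr_ge0// ltW.
Qed.

Lemma ball_growth_axis_measure : (ball_growth N%:R^-1 axis_measure < +oo)%E.
Proof.
apply: (@le_lt_trans _ _ (4 * 2 `^ N%:R^-1 : R)%:E); last exact: ltry.
apply: ge_ereal_sup => _ [[x r] /= r0 <-].
have rN : 0 < r `^ N%:R^-1 by rewrite powR_gt0.
rewrite inver gt_eqF// lee_pdivrMr// axis_measureE.
rewrite (_ : (4 * 2 `^ N%:R^-1)%:E * _ = (2 * (2 * r) `^ N%:R^-1)%:E + (2 * (2 * r) `^ N%:R^-1)%:E)%E.
  apply: leeD; apply: branch_ball => //.
  - exact: measurable_posbranch.
  - by move=> u v _ _; rewrite !axis_coord.
  - exact: measurable_negbranch.
  - by move=> u v _ _; rewrite !axis_coord -opprD normrN.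
by rewrite -EFinM -EFinD; congr EFin; rewrite powRM ?ltW//; ring.
Qed.

End axis_measure.

(** * Upper bound for the Sobolev norm *)
Section sobolev_upper_bound.
Context {R : realType}.
Variable n : nat.
Hypothesis n_ge2 : (2 <= n)%N.

Let n_gt0 : (0 < n)%N. Proof. exact: ltnW. Qed.

Notation V := 'rV[R]_n.
Notation lebV := (@lebesgue_rV R n).

Local Notation gshape := (@gshape R n).

Lemma gshape_ge1 k : 1 <= gshape k :> R.
Proof.
rewrite /gshape (@le_trans _ _ (n%:R / 2))//; last by rewrite lerDr.
by rewrite ler_pdivlMr// mul1r ler_nat.
Qed.

(** The square of the test density is a density of the same family, so that its
    L^2 norm is a moment too. *)
Lemma radgau_sqr k (x : V) : radgau pi k x ^+ 2 = radgau (2 * pi) (2 * k) x.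
Proof.
rewrite /radgau exprMn -exprM mulnC; congr (_ * _).
by rewrite !gauVE expr2 -expRD; congr expR; ring.
Qed.

Lemma rmoment_shift_le a k j : 0 < a ->
  rmoment n a (k + j) <= (gshape (k + j) / a) ^+ j * rmoment n a k.
Proof.
move=> a0; have H0 m : 0 <= rmoment n a m by apply: Rintegral_ge0 => x _; exact: radgau_ge0.
have g0 m : 0 <= gshape m / a by rewrite divr_ge0 ?ltW// gshape_gt0.
suff H i : (i <= j)%N -> rmoment n a (k + i) <= (gshape (k + j) / a) ^+ i * rmoment n a k.
  exact: H.
elim: i => [|i IH] ij; first by rewrite addn0 mul1r.
rewrite addnS rmomentS// exprS -[leRHS]mulrA; apply: ler_pM => //.
- by rewrite ler_pM2r ?invr_gt0// lerD2r ler_nat leq_add2l ltnW.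
- by apply: IH; exact: ltnW.
Qed.

(** The symbol of 1 - Laplacian. *)
Definition bweight (x : V) : R := 1 + 4 * pi ^+ 2 * enorm x ^+ 2.

Lemma bweight_ge1 x : 1 <= bweight x.
Proof. by rewrite lerDl mulr_ge0 ?sqr_ge0// mulr_ge0// sqr_ge0. Qed.

Lemma bweight_ge0 x : 0 <= bweight x.
Proof. exact: le_trans (bweight_ge1 x). Qed.

Lemma bweightX_le x : bweight x ^+ n <=
  2 ^+ n + (8 * pi ^+ 2) ^+ n * dotv x x ^+ n.
Proof.
rewrite /bweight enorm_sqr; set v := dotv x x.
have v0 : 0 <= v := dotvv_ge0 x.
have c0 : 0 <= 4 * pi ^+ 2 * v by rewrite mulr_ge0// mulr_ge0// sqr_ge0.
rewrite -exprMn (_ : 8 * pi ^+ 2 * v = 2 * (4 * pi ^+ 2 * v)); last by ring.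
move: (4 * _ * v) c0 => w w0.
have [w1|w1] := leP w 1.
  rewrite (@le_trans _ _ (2 ^+ n))//.
    by rewrite lerXn2r ?nnegrE ?addr_ge0//; lra.
  by rewrite lerDl exprn_ge0// mulr_ge0.
rewrite (@le_trans _ _ ((2 * w) ^+ n))//.
  by rewrite lerXn2r ?nnegrE ?addr_ge0 ?mulr_ge0//; lra.
by rewrite lerDr exprn_ge0.
Qed.

Lemma measurable_bweight : measurable_fun setT bweight.
Proof.
rewrite (_ : bweight = fun x => 1 + 4 * pi ^+ 2 * dotv x x); last first.
  by apply/funext => x; rewrite /bweight enorm_sqr.
by apply: measurable_funD => //; apply: measurable_funM => //; exact: measurable_dotv.
Qed.

(** An explicit integrable majorant of all the weighted densities in use, by
    [bweightX_le]. *)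
Definition heavy a k (x : V) : R :=
  2 ^+ n * radgau a k x + (8 * pi ^+ 2) ^+ n * radgau a (k + n) x.

Lemma intble_heavy a k : 0 < a -> intble lebV (heavy a k).
Proof. by move=> a0; apply: intbleD; apply: intbleZ; exact: intble_radgau. Qed.

Lemma heavyE a k x :
  heavy a k x = (2 ^+ n + (8 * pi ^+ 2) ^+ n * dotv x x ^+ n) * radgau a k x.
Proof. by rewrite /heavy -dotv_radgau; ring. Qed.

Lemma powR_bweight_le x (s : R) : s <= n%:R -> bweight x `^ s <= bweight x ^+ n.
Proof.
by move=> sn; rewrite -powR_mulrn ?bweight_ge0// ler_powR// bweight_ge1.
Qed.

Lemma intble_weighted a k (s : R) : 0 < a -> s <= n%:R ->
  intble lebV (fun x => bweight x `^ s * radgau a k x).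
Proof.
move=> a0 sn; apply: (@intble_le _ _ _ lebV _ (heavy a k)).
- apply: measurable_funM; last exact: intble_measurable (intble_radgau n k a0).
  apply: (measurableT_comp (measurable_powR s)); exact: measurable_bweight.
- move=> x; rewrite heavyE ger0_norm; last by rewrite mulr_ge0 ?powR_ge0 ?radgau_ge0.
  rewrite ler_wpM2r ?radgau_ge0// (le_trans (powR_bweight_le x sn))//.
  exact: bweightX_le.
- exact: intble_heavy.
Qed.

Definition sob_const : R := 1 + 2 ^+ n + (24 * pi ^+ 2) ^+ n.

(** With D = k + n/2, the weight is of order D where the mass is:
    (w / D)^s <= 1 + (w / D)^n, and the n-th moment is D^n up to a constant by
    [rmoment_shift_le]. *)
Lemma weighted_integral_le k (s : R) : s <= n%:R -> 0 <= s ->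
  \int[lebV]_x (bweight x `^ s * radgau (2 * pi) (2 * k) x) <=
  gshape k `^ s * sob_const * rmoment n (2 * pi) (2 * k).
Proof.
move=> sn s0; set D := gshape k; have D0 : 0 < D := gshape_gt0 k n_gt0.
have pi2 : 0 < 2 * pi :> R by rewrite mulr_gt0// pi_gt0.
have ig j : intble lebV (radgau (2 * pi) j) by exact: intble_radgau.
apply: (@le_trans _ _ (\int[lebV]_x (D `^ s * (radgau (2 * pi) (2 * k) x +
   (D ^+ n)^-1 * heavy (2 * pi) (2 * k) x)))).
  apply: le_Rintegral => //.
  - exact: intble_weighted.
  - by apply: intbleZ; apply: intbleD => //; apply: intbleZ; exact: intble_heavy.
  - move=> x _; rewrite heavyE [_ + _](_ : _ = (1 + (D ^+ n)^-1 *
       (2 ^+ n + (8 * pi ^+ 2) ^+ n * dotv x x ^+ n)) * radgau (2 * pi) (2 * k) x); last by ring.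
    rewrite [leRHS]mulrA ler_wpM2r ?radgau_ge0//.
    apply: (@le_trans _ _ (D `^ s * (1 + (D ^+ n)^-1 * bweight x ^+ n))); last first.
      by rewrite ler_wpM2l ?powR_ge0// lerD2l ler_wpM2l ?invr_ge0 ?exprn_ge0 ?(ltW D0)// bweightX_le.
    rewrite -exprVn -exprMn; set w := D^-1 * bweight x.
    have w0 : 0 <= w by rewrite mulr_ge0 ?bweight_ge0// invr_ge0 ltW.
    have -> : bweight x = D * w by rewrite /w mulrA divff ?mul1r ?gt_eqF.
    rewrite powRM ?(ltW D0)// ler_wpM2l ?powR_ge0//.
    have [w1|w1] := leP w 1.
      rewrite (@le_trans _ _ 1)//; last by rewrite lerDl exprn_ge0.
      apply: (@le_trans _ _ (1 `^ s)); last by rewrite powR1.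
      by apply: ge0_ler_powR => //; rewrite nnegrE.
    rewrite (@le_trans _ _ (w ^+ n))//; last by rewrite lerDr.
    by rewrite -powR_mulrn// ler_powR// ltW.
rewrite RintegralZl//; last first.
  by apply: intbleD => //; apply: intbleZ; exact: intble_heavy.
rewrite RintegralD//; last by apply: intbleZ; exact: intble_heavy.
rewrite RintegralZl//; last exact: intble_heavy.
rewrite RintegralD//; [|exact: intbleZ|exact: intbleZ].
rewrite !RintegralZl// -!/(rmoment _ _ _) -[leRHS]mulrA ler_wpM2l ?powR_ge0//.
set B := rmoment n (2 * pi) (2 * k).
have B0 : 0 < B by exact: rmoment_gt0.
have H : rmoment n (2 * pi) (2 * k + n) <= (3 * D) ^+ n * B.
  apply: (le_trans (rmoment_shift_le _ _ pi2)); rewrite ler_wpM2r ?(ltW B0)//.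
  have g0 : 0 <= gshape (2 * k + n) by rewrite ltW// gshape_gt0.
  rewrite lerXn2r ?nnegrE//; [by rewrite divr_ge0// ltW|by rewrite mulr_ge0// ltW|].
  rewrite (@le_trans _ _ (gshape (2 * k + n)))//.
    by rewrite ler_piMr// invf_le1//; have := pi_ge2 R; lra.
  rewrite /D /gshape natrD natrM; have := ler0n R k; lra.
have Dn1 : 1 <= D by exact: gshape_ge1.
have Dn : (D ^+ n)^-1 <= 1 by rewrite invf_le1 ?exprn_gt0// exprn_ege1.
have -> : sob_const * B = B + (2 ^+ n * B + (24 * pi ^+ 2) ^+ n * B).
  by rewrite /sob_const; ring.
rewrite lerD2l mulrDr lerD//.
  by rewrite ler_piMl// mulr_ge0// ?exprn_ge0// ltW.
have Di0 : 0 <= (D ^+ n)^-1 by rewrite invr_ge0 exprn_ge0// ltW.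
apply: (le_trans (ler_wpM2l Di0 (ler_wpM2l (exprn_ge0 n (mulr_ge0 (ler0n R 8) (sqr_ge0 pi))) H))).
rewrite le_eqVlt; apply/orP; left; apply/eqP.
rewrite (exprMn _ 3 D) (_ : 24 * pi ^+ 2 = (8 * pi ^+ 2) * 3 :> R); last by ring.
rewrite [in RHS]exprMn; move: ((8 * pi ^+ 2) ^+ n) (3 ^+ n) => c t; field.
by rewrite expf_neq0// gt_eqF.
Qed.

End sobolev_upper_bound.

(** * Comparison of the L^1 and L^2 norms *)
Section concentration.
Context {R : realType}.
Variable n : nat.
Hypothesis n_ge2 : (2 <= n)%N.

Let n_gt0 : (0 < n)%N. Proof. exact: ltnW. Qed.
Local Notation gshape := (@gshape R n).

(** The quotient of the squared L^1 and L^2 norms of the test density; it is of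
    the order of the volume of the shell that carries the mass. *)
Definition spread k : R := rmoment n pi k ^+ 2 / rmoment n (2 * pi) (2 * k).

Lemma spread_gt0 k : 0 < spread k.
Proof.
have pi2 : 0 < 2 * pi :> R by rewrite mulr_gt0// pi_gt0.
by rewrite divr_gt0 ?exprn_gt0// rmoment_gt0// pi_gt0.
Qed.

(** With a = k + n/2 and nu = n/2, the quotient of consecutive values is the
    inverse of (1 - nu / (2a)) (1 - (nu - 1) / (2a)), which 1 - x <= e^(-x) bounds
    by e^(- theta / a); and (1 + 1/a)^theta <= e^(theta / a). *)
Lemma spreadS k (theta := (n%:R - 1) / 2) :
  spread k * (gshape k.+1 / gshape k) `^ theta <= spread k.+1.
Proof.
have pi2 : 0 < 2 * pi :> R by rewrite mulr_gt0// pi_gt0.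
have nu1 : 1 <= n%:R / 2 :> R by rewrite ler_pdivlMr// mul1r ler_nat.
set a : R := gshape k; have a1 : 1 <= a := gshape_ge1 n_ge2 k.
set nu : R := n%:R / 2; have anu : a = k%:R + nu by [].
have k0 : 0 <= k%:R :> R by exact: ler0n.
have a0 : 0 < a by lra.
have p1 : 0 < 2 * a - nu by lra.
have p2 : 0 < 2 * a - nu + 1 by lra.
have E : spread k.+1 = spread k * ((2 * a) ^+ 2 / ((2 * a - nu) * (2 * a - nu + 1))).
  rewrite /spread mulnS add2n !rmomentS ?pi_gt0// /gshape -/nu.
  have -> : (2 * k).+1%:R + nu = 2 * a - nu + 1 by rewrite -natr1 natrM anu; ring.
  have -> : (2 * k)%:R + nu = 2 * a - nu by rewrite natrM anu; ring.
  rewrite -anu.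
  have B0 : 0 < rmoment n (2 * pi) (2 * k) :> R by rewrite rmoment_gt0.
  move: (rmoment n (2 * pi) (2 * k)) B0 (rmoment n pi k) => B B0 A.
  move: (pi : R) (pi_gt0 R) => P P0.
  by field; rewrite !gt_eqF.
rewrite E ler_pM2l ?spread_gt0//.
have -> : gshape k.+1 / a = 1 + a^-1.
  by rewrite /gshape -natr1 addrAC -/(gshape k) -/a mulrDl divff ?mul1r// gt_eqF.
apply: (@le_trans _ _ (expR (theta / a))).
  have ia0 : 0 < a^-1 by rewrite invr_gt0.
  rewrite /powR gt_eqF; last by rewrite addr_gt0.
  rewrite ler_expR ler_wpM2l//.
    by rewrite divr_ge0// subr_ge0 ler1n.
  by apply: le_ln1Dx; rewrite (lt_trans _ ia0)// ltrN10.
rewrite ler_pdivlMr ?mulr_gt0//.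
have e1 : 1 - nu / (2 * a) <= expR (- (nu / (2 * a))) by exact: expR_ge1Dx.
have e2 : 1 - (nu - 1) / (2 * a) <= expR (- ((nu - 1) / (2 * a))) by exact: expR_ge1Dx.
have f1 : 1 - nu / (2 * a) = (2 * a - nu) / (2 * a) by field; rewrite gt_eqF.
have f2 : 1 - (nu - 1) / (2 * a) = (2 * a - nu + 1) / (2 * a) by field; rewrite gt_eqF.
have a20 : 0 < 2 * a by rewrite mulr_gt0.
have H : (1 - nu / (2 * a)) * (1 - (nu - 1) / (2 * a)) <= expR (- (theta / a)).
  rewrite (_ : - (theta / a) = - (nu / (2 * a)) + - ((nu - 1) / (2 * a))).
    by rewrite expRD ler_pM// ?f1 ?f2 ?divr_ge0 ?ltW.
  by rewrite /theta /nu; field; rewrite gt_eqF.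
have -> : (2 * a - nu) * (2 * a - nu + 1) =
   (2 * a) ^+ 2 * ((1 - nu / (2 * a)) * (1 - (nu - 1) / (2 * a))).
  by field; rewrite gt_eqF.
rewrite mulrCA ler_piMr ?sqr_ge0//.
apply: (le_trans (ler_wpM2l (expR_ge0 _) H)).
by rewrite -expRD subrr expR0.
Qed.

Lemma spread_ge k (theta := (n%:R - 1) / 2) :
  spread 0 * (gshape k / gshape 0) `^ theta <= spread k.
Proof.
have g0 j : 0 < gshape j :> R by exact: (gshape_gt0 _ n_gt0).
elim: k => [|k IH]; first by rewrite divff ?gt_eqF// powR1 mulr1.
apply: le_trans (spreadS k); apply: le_trans (ler_wpM2r (powR_ge0 _ _) IH).
rewrite -[leRHS]mulrA -powRM ?divr_ge0 ?(ltW (g0 _))//.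
rewrite (_ : gshape k / gshape 0 * (gshape k.+1 / gshape k) = gshape k.+1 / gshape 0)//.
by rewrite mulrC mulrA divfK ?gt_eqF.
Qed.

End concentration.

(** * The estimate for the test functions *)
Lemma root_ge (R : realType) (p u w : R) : 1 <= p -> 0 <= u -> 0 < w -> w <= 1 ->
  u * w <= (u `^ p * w) `^ p^-1.
Proof.
move=> p1 u0 w0 w1; have p0 : 0 < p by rewrite (lt_le_trans _ p1).
rewrite powRM ?powR_ge0 ?(ltW w0)// -powRrM divff ?gt_eqF// powRr1// ler_wpM2l//.
have := @ger_powR _ w; rewrite w0 w1 => /(_ isT p^-1 1).
by rewrite powRr1 ?(ltW w0)//; apply; rewrite invf_le1.
Qed.

Section test_estimate.
Context {R : realType}.
Variables (n N : nat) (gamma p : R).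
Hypotheses (n_ge2 : (2 <= n)%N) (N_gt0 : (0 < N)%N) (p_gt1 : 1 < p) (gamma_ge0 : 0 <= gamma).
Notation V := 'rV[R]_n.
Notation leb := (@lebesgue_measure R).
Notation lebV := (@lebesgue_rV R n).

Let n_gt0 : (0 < n)%N. Proof. exact: ltnW. Qed.
Let i0 : 'I_n := Ordinal n_gt0.
Let mu : {measure set V -> \bar R} := axis_measure i0 N.

Definition sradius k : R := Num.sqrt (rad2 n k).

(** Lower bound for the mass that [mu] gives to the segment on which the wave is
    large; that segment has half-length [focus k ^+ N]. *)
Definition focus k : R := (64 * sradius k)^-1 `^ N%:R^-1.

Let s := (n%:R - N%:R^-1) / 2 - gamma.

(** The Fourier transform of (1 - Laplacian)^(s/2) u0. *)
Definition tested k (x : V) : R := bweight x `^ (s / 2) * radgau pi k x.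

Lemma sradius_gt0 k : 0 < sradius k.
Proof. by rewrite sqrtr_gt0 rad2_gt0. Qed.

Lemma focusX k : focus k ^+ N = (64 * sradius k)^-1.
Proof.
have r0 := sradius_gt0 k.
rewrite /focus -powR_mulrn ?powR_ge0// -powRrM mulVf ?pnatr_eq0 -?lt0n//.
by rewrite powRr1// invr_ge0 mulr_ge0// ltW.
Qed.

Lemma focus_le1 k : 1 <= sradius k -> focus k <= 1.
Proof.
move=> r1; apply: (@le_trans _ _ (1 `^ N%:R^-1)); last by rewrite powR1.
have r0 : 0 < 64 * sradius k by rewrite mulr_gt0// (lt_le_trans _ r1).
apply: ge0_ler_powR; rewrite ?nnegrE ?invr_ge0 ?(ltW r0)//.
by rewrite invf_le1//; lra.
Qed.

(** The main term is at least A / 2 and the error at most A / 4. *)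
Lemma wave_large k (f : V -> R) (t c : R) :
  (forall xi, fourier (fun x => (f x)%:C%C) xi = (radgau pi k xi)%:C%C) ->
  large_cos (2 * pi * sradius k) ((n%:R - 1) / 4 * pi) t ->
  `|c| <= focus k ^+ N ->
  rmoment n pi k / 4 <= normC (wave f (axis i0 c) t).
Proof.
move=> ff [/= + tc] cs; rewrite in_itv/= => t01; apply: le_trans (normC_wave_ge _ _ ff).
have r0 := sradius_gt0 k.
have cr : `|c| * sradius k <= 64^-1.
  apply: (le_trans (ler_wpM2r (ltW r0) cs)); rewrite focusX invfM -mulrA mulVf ?mulr1//.
  by rewrite gt_eqF.
have := @wave_integral_close R n n_gt0 k i0 c t ((n%:R - 1) / 4 * pi) cr t01.
rewrite -/(axis i0 c) -/(sradius k).
set I := \int[_]_x _; set A := rmoment n pi k => close.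
have A0 : 0 < A by rewrite rmoment_gt0// pi_gt0.
have E : 2 * pi * t * sradius k = 2 * pi * sradius k * t by ring.
rewrite E in close.
set C := cos _ in close tc.
have : `|C * A| <= `|I| + `|I - C * A|.
  by rewrite [X in `|X| <= _](_ : _ = I - (I - C * A)); [exact: ler_normB|ring].
rewrite normrM (gtr0_norm A0) => h.
have : 2^-1 * A <= `|C| * A by rewrite ler_wpM2r// ltW.
by move: close; lra.
Qed.

Lemma s_le : s <= n%:R.
Proof.
have : 0 <= N%:R^-1 :> R by rewrite invr_ge0.
have := ler0n R n; have := gamma_ge0.
by rewrite /s; lra.
Qed.

Lemma s2_le : s / 2 <= n%:R.
Proof. by have := s_le; have := ler0n R n; lra. Qed.

Lemma tested_sqr k x : tested k x ^+ 2 = bweight x `^ s * radgau (2 * pi) (2 * k) x.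
Proof.
rewrite /tested exprMn radgau_sqr; congr (_ * _).
by rewrite -powR_mulrn ?powR_ge0// -powRrM divfK// pnatr_eq0.
Qed.

(** The diameter of the support and the growth constant of [mu] do not depend
    on k, so they only enter the constant K.  The factor [focus k] appears to the
    power 1/p in the estimate; it is at most 1, whence [root_ge]. *)
Lemma tested_estimate : @wave_estimate R n N%:R^-1 gamma p ->
  exists2 K : R, 0 <= K & forall k, 128 <= sradius k ->
    rmoment n pi k * focus k <= K * Num.sqrt (\int[lebV]_x tested k x ^+ 2).
Proof.
move=> [C HC].
pose D := C (diameter (msupport mu)).
have p0 : 0 < p by rewrite (lt_trans _ p_gt1).
have bg0 : (0 <= ball_growth N%:R^-1 mu)%E.
  apply: (@le_trans _ _ (mu (eball (0 : V) 1) / (1 `^ N%:R^-1)%:E)%E).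
    by rewrite powR1 inve1 mule1 measure_ge0.
  by apply: ereal_sup_ubound; exists (0, 1) => //=.
have bgoo := @ball_growth_axis_measure R n i0 N N_gt0.
pose g := fine (ball_growth N%:R^-1 mu).
have gE : ball_growth N%:R^-1 mu = g%:E.
  by rewrite /g fineK// ge0_fin_numE; [exact: bgoo|exact: bg0].
have g0 : 0 <= g by rewrite fine_ge0.
exists (4 * (512 * (`|D| * g `^ p^-1))).
  by do 2 (apply: mulr_ge0; first exact: ler0n); rewrite mulr_ge0// powR_ge0.
move=> k rk.
have r0 := sradius_gt0 k.
have [f [pf fN cf sf]] := @realizable_radgau R n k.
have ff := fourier_real (polygau_intble pf) cf sf.
have := HC f mu (polygau_schwartz pf) fN
  (@compact_support_axis_measure R n i0 N) (@even_axis_measure R n i0 N) bgoo.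
rewrite -/D gE poweR_EFin -/s => est.
set A := rmoment n pi k; have A0 : 0 < A by rewrite rmoment_gt0// pi_gt0.
set S := Num.sqrt _.
have pi2 : 0 < 2 * pi :> R by rewrite mulr_gt0// pi_gt0.
have A4 : 0 <= A / 4 by rewrite divr_ge0// ltW.
have r1 : 1 <= sradius k by lra.
have foc0 : 0 < focus k by rewrite powR_gt0// invr_gt0 mulr_gt0.
have foc1 := focus_le1 r1.
have sobS : (sobolev_norm s f <= S%:E)%E.
  apply: (sobolev_norm_le ff (G := tested k)) => //.
    by apply: intble_weighted => //; [exact: pi_gt0|exact: s2_le].
  have iw := @intble_weighted R n (2 * pi) (2 * k) s pi2 s_le.
  by apply: eq_intble iw => x; rewrite tested_sqr.
have sob0 : (0 <= sobolev_norm s f)%E by exact: Lnorm_ge0.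
have up : (D%:E * (g `^ p^-1)%:E * sobolev_norm s f <= (`|D| * g `^ p^-1 * S)%:E)%E.
  rewrite -EFinM; apply: (@le_trans _ _ ((`|D| * g `^ p^-1)%:E * sobolev_norm s f)%E).
    by apply: lee_wpmul2r => //; rewrite lee_fin ler_wpM2r ?powR_ge0// ler_norm.
  by rewrite [leRHS]EFinM; apply: lee_wpmul2l => //; rewrite lee_fin mulr_ge0// powR_ge0.
pose E := large_cos (2 * pi * sradius k) ((n%:R - 1) / 4 * pi).
pose c := (A / 4) `^ p.
have c0 : 0 <= c by exact: powR_ge0.
have inner t : E t -> ((c * focus k)%:E <= \int[mu]_x (normC (wave f x t) `^ p)%:E)%E.
  move=> Et.
  apply: (@le_trans _ _ (c%:E * mu (axis_segment i0 (focus k ^+ N)))%E).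
    rewrite EFinM; apply: lee_wpmul2l; first by rewrite lee_fin.
    by apply: axis_measure_segment => //; rewrite foc1 andbT ltW.
  apply: ge0_le_integral_set => //.
  - by apply: closed_measurable_rV => x; exact: closed_axis_segment.
  - by move=> x _; rewrite lee_fin powR_ge0.
  - move=> x [y /= yI <-]; rewrite lee_fin.
    have h : A / 4 <= normC (wave f (axis i0 y) t).
      by apply: wave_large => //; rewrite ler_norml; move: yI; rewrite in_itv.
    apply: ge0_ler_powR => //; rewrite ?nnegrE//; first exact: ltW.
    exact: le_trans h.
have b512 : 512 <= 2 * pi * sradius k.
  have := ler_pM (ler0n R 4) (ler0n R 128) (_ : 4 <= 2 * pi) rk.
  have := pi_ge2 R => p2 /(_ _); rewrite (_ : 512 = 4 * 128); last by ring.
  by apply; lra.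
have low : ((c * focus k / 512)%:E <=
    \int[leb]_(t in `[0%R, 1%R]) \int[mu]_x (normC (wave f x t) `^ p)%:E)%E.
  apply: (@le_trans _ _ ((c * focus k)%:E * leb E)%E).
    rewrite EFinM; apply: lee_wpmul2l; first by rewrite lee_fin mulr_ge0// ltW.
    exact: large_cos_measure.
  apply: ge0_le_integral_set => //.
  - exact: measurable_large_cos.
  - move=> t [/= + _]; rewrite !in_itv/= => /andP[-> t1] /=.
    by rewrite (le_trans t1)// invf_le1// ler1n.
  - by rewrite mulr_ge0// ltW.
  - by move=> t _; apply: integral_ge0 => x _; rewrite lee_fin powR_ge0.
have w0 : 0 < focus k / 512 by rewrite divr_gt0// ltr0n.
have X0 : 0 <= c * focus k / 512 by rewrite -mulrA mulr_ge0// ltW.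
have main : ((c * focus k / 512) `^ p^-1 <= `|D| * g `^ p^-1 * S).
  rewrite -lee_fin -poweR_EFin; apply: le_trans up; apply: le_trans est.
  apply: gt0_ler_poweR => //; first by rewrite invr_ge0 ltW.
  - by rewrite in_itv/= lee_fin X0 leey.
  - by rewrite in_itv/= leey andbT (le_trans _ low).
have w1 : focus k / 512 <= 1 by lra.
have := le_trans (root_ge (ltW p_gt1) A4 w0 w1) _.
rewrite mulrA => /(_ _ main) {w0 w1 X0 main low b512}.
rewrite (_ : 4 * (512 * (`|D| * g `^ p^-1)) * S = 4 * 512 * (`|D| * g `^ p^-1 * S)); last by ring.
by move: (`|D| * _ * _) => z; lra.
Qed.

End test_estimate.

(** * The bound on the exponent *)
Section exponent_bound.
Context {R : realType}.
Variables (n : nat).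
Hypotheses (n_ge2 : (2 <= n)%N).
Notation V := 'rV[R]_n.
Notation lebV := (@lebesgue_rV R n).

Let n_gt0 : (0 < n)%N. Proof. exact: ltnW. Qed.

Lemma powR_bounded_le0 (delta M : R) :
  (exists2 k0 : R, 0 <= k0 & forall k, k0 <= k%:R -> gshape n k `^ delta <= M) -> delta <= 0.
Proof.
move=> [k0 k00 H]; rewrite leNgt; apply/negP => d0.
pose k1 := (`|M| + 1) `^ delta^-1.
have k10 : 0 <= k1 by exact: powR_ge0.
have kP := archi_boundP (addr_ge0 k00 k10).
set k := Num.bound _ in kP.
have kk0 : k0 <= k%:R by rewrite ltW// (le_lt_trans _ kP)// lerDl.
have kk1 : k1 <= gshape n k.
  rewrite /gshape (@le_trans _ _ k%:R)//; last by rewrite lerDl divr_ge0.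
  by rewrite ltW// (le_lt_trans _ kP)// lerDr.
have := H _ kk0; apply/negP; rewrite -ltNge.
apply: (@lt_le_trans _ _ (k1 `^ delta)).
  rewrite /k1 -powRrM mulVf ?gt_eqF// powRr1 ?addr_ge0//.
  by rewrite (le_lt_trans (ler_norm M))// ltrDl.
have g0 : 0 <= gshape n k :> R := le_trans k10 kk1.
by apply: ge0_ler_powR; rewrite ?nnegrE ?(ltW d0).
Qed.

Lemma sradius_large k : 4 * 128 ^+ 2 <= k%:R :> R -> 128 <= @sradius R n k.
Proof.
move=> hk; rewrite -[128](ger0_norm (ler0n R 128)) -sqrtr_sqr ler_wsqrtr//.
rewrite /rad2 ler_pdivlMr ?pi_gt0// (@le_trans _ _ (4 * 128 ^+ 2))//.
  by rewrite mulrC ler_wpM2r ?exprn_ge0// pi_le4.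
by rewrite (le_trans hk)// lerDl divr_ge0.
Qed.

(** Squaring the tested estimate gives, with D = k + n/2 and sigma = max (s, 0),
    that D^(theta - alpha - sigma) stays bounded as k grows, hence
    theta <= alpha + sigma.  If s <= 0 this reads (n - 1)/2 <= 1/N, which is false
    for N >= 3; otherwise it is the claim. *)
Lemma gamma_le (N : nat) (gamma p : R) : (3 <= N)%N -> 0 <= gamma -> 1 < p ->
  @wave_estimate R n N%:R^-1 gamma p -> gamma <= 1 / 2 + N%:R^-1.
Proof.
move=> N3 g0 p1 est; have N0 : (0 < N)%N by exact: leq_trans N3.
have [K K0 HK] := tested_estimate n_ge2 N0 p1 g0 est.
set alpha : R := N%:R^-1 in est HK *.
have a0 : 0 <= alpha by rewrite invr_ge0.
have a13 : alpha <= 3^-1 by rewrite /alpha lef_pV2 ?posrE ?ltr0n// ler_nat.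
set s := (n%:R - alpha) / 2 - gamma in HK.
have n2 : 2 <= n%:R :> R by rewrite ler_nat.
pose sigma := Num.max s 0.
have sig0 : 0 <= sigma by rewrite le_max lexx orbT.
have sign : sigma <= n%:R by rewrite ge_max ler0n andbT /s; lra.
have sn : s <= n%:R by rewrite /s; lra.
have pi2 : 0 < 2 * pi :> R by rewrite mulr_gt0// pi_gt0.
pose theta : R := (n%:R - 1) / 2.
have c1 : 0 < spread n 0 * (gshape n 0)^-1 `^ theta * (64 ^+ 2)^-1 `^ alpha :> R.
  apply: mulr_gt0; last by rewrite powR_gt0// invr_gt0 exprn_gt0.
  apply: mulr_gt0; first exact: spread_gt0.
  by rewrite powR_gt0// invr_gt0 gshape_gt0.
set c := _ * _ in c1.
pose M := K ^+ 2 * sob_const n / c.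
have main k : 4 * 128 ^+ 2 <= k%:R :> R -> gshape n k `^ (theta - alpha - sigma) <= M.
  move=> hk; set D := gshape n k; have D0 : 0 < D := gshape_gt0 k n_gt0.
  have := HK k (sradius_large hk).
  set A := rmoment n pi k; set B : R := rmoment n (2 * pi) (2 * k).
  have A0 : 0 < A by rewrite rmoment_gt0// pi_gt0.
  have B0 : 0 < B by rewrite rmoment_gt0.
  set I := \int[_]_x _.
  have I0 : 0 <= I by apply: Rintegral_ge0 => x _; exact: sqr_ge0.
  have IB : I <= D `^ sigma * sob_const n * B.
    apply: le_trans (weighted_integral_le n_ge2 k sign sig0).
    apply: le_Rintegral => //.
    - apply: eq_intble (@intble_weighted R n (2 * pi) (2 * k) s pi2 sn) => x.
      by rewrite tested_sqr.
    - exact: intble_weighted.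
    - move=> x _; rewrite tested_sqr ler_wpM2r ?radgau_ge0// ler_powR ?bweight_ge1//.
      by rewrite le_max lexx.
  move=> h.
  have h2 : A ^+ 2 * focus n N k ^+ 2 <= K ^+ 2 * (D `^ sigma * sob_const n * B).
    rewrite -exprMn (@le_trans _ _ ((K * Num.sqrt I) ^+ 2))//.
      by rewrite lerXn2r ?nnegrE ?mulr_ge0 ?powR_ge0 ?sqrtr_ge0 ?(ltW A0).
    by rewrite exprMn sqr_sqrtr// ler_wpM2l// sqr_ge0.
  have h3 : spread n k * focus n N k ^+ 2 <= K ^+ 2 * sob_const n * D `^ sigma.
    rewrite /spread mulrAC ler_pdivrMr// (le_trans h2)//.
    by rewrite le_eqVlt; apply/orP; left; apply/eqP; rewrite -/B; ring.
  have F : (64 ^+ 2)^-1 `^ alpha * D `^ (- alpha) <= focus n N k ^+ 2.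
    have r0 := @sradius_gt0 R n n_ge2 k.
    rewrite /focus -powR_mulrn ?powR_ge0// -powRrM -/alpha [alpha * _]mulrC powRrM.
    rewrite powR_mulrn; last by rewrite invr_ge0 mulr_ge0// ltW.
    rewrite -mulN1r powRrM powR_inv1 ?(ltW D0)// -powRM ?invr_ge0 ?exprn_ge0 ?(ltW D0)//.
    apply: ge0_ler_powR => //; rewrite ?nnegrE ?mulr_ge0 ?invr_ge0 ?exprn_ge0 ?mulr_ge0 ?(ltW r0) ?(ltW D0)//.
    rewrite -invfM exprVn lef_pV2 ?posrE ?mulr_gt0 ?exprn_gt0 ?mulr_gt0//.
    rewrite exprMn ler_wpM2l ?exprn_ge0//.
    rewrite sqr_sqrtr; last by rewrite ltW// rad2_gt0.
    by rewrite /rad2 ler_pdivrMr ?pi_gt0// ler_peMr ?(ltW D0)//; have := pi_ge2 R; lra.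
  have G : spread n 0 * (gshape n 0)^-1 `^ theta * D `^ theta <= spread n k.
    apply: le_trans (@spread_ge R n n_ge2 k).
    by rewrite -mulrA -powRM ?invr_ge0 ?(ltW D0) ?(ltW (gshape_gt0 0 n_gt0))// mulrC [_^-1 * _]mulrC mulrC.
  have h4 : c * D `^ (theta - alpha) <= K ^+ 2 * sob_const n * D `^ sigma.
    apply: le_trans h3; rewrite powRD; last by rewrite (gt_eqF D0) implybT.
    rewrite /c [leLHS](_ : _ = (spread n 0 * (gshape n 0)^-1 `^ theta * D `^ theta) *
      ((64 ^+ 2)^-1 `^ alpha * D `^ (- alpha))); last by ring.
    apply: ler_pM; [|by rewrite mulr_ge0 ?powR_ge0|exact: G|exact: F].
    by rewrite mulr_ge0 ?powR_ge0// mulr_ge0 ?powR_ge0// (ltW (spread_gt0 n_ge2 0)).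
  rewrite powRD; last by rewrite (gt_eqF D0) implybT.
  rewrite powRN /M ler_pdivlMr// mulrC mulrA ler_pdivrMr ?powR_gt0//.
have ex : exists2 k0 : R, 0 <= k0 & forall k, k0 <= k%:R ->
    gshape n k `^ (theta - alpha - sigma) <= M.
  by exists (4 * 128 ^+ 2); [rewrite mulr_ge0// exprn_ge0|exact: main].
have := powR_bounded_le0 ex; rewrite /sigma /theta.
have [s0|s0] := leP s 0; first by rewrite subr0; lra.
by rewrite /s; lra.
Qed.

End exponent_bound.

Theorem mainTheorem2 (R : realType) (n : nat) (hn : (2 <= n)%N) :
  (ereal_inf [set gamma_sup n alpha | alpha in `]0%R, (n%:R / 2 : R)%R[]
   <= (1 / 2)%:E)%E.
Proof.
apply/lee_addgt0Pr => e e0.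
have := archi_boundP (ltW (_ : 0 < e^-1)); rewrite invr_gt0 => /(_ e0).
set N := Num.bound _ => eN.
pose m := N.+3.
have m0 : 0 < m%:R :> R by rewrite ltr0n.
apply: (@le_trans _ _ (gamma_sup n (m%:R^-1 : R))).
  apply: ereal_inf_lbound; exists m%:R^-1 => //=.
  rewrite in_itv/= invr_gt0 m0/= (@lt_le_trans _ _ 1)//.
    by rewrite invf_lt1// ltr1n.
  by rewrite ler_pdivlMr// mul1r ler_nat.
apply: ge_ereal_sup => _ [gamma [g0 [p [p1 est]]] <-].
rewrite -EFinD lee_fin (le_trans (gamma_le hn _ g0 p1 est))//.
rewrite lerD2l -[e]invrK lef_pV2 ?posrE ?invr_gt0//.
by rewrite ltW// (lt_le_trans eN)// ler_nat /m -addn3 leq_addr.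
Qed.
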